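(* Let $\tau\in L^{1}_{loc}(\mathbb{R})$ vanish on $(-\infty,0)$ and have convergent (improper) Laplace transform $\mathcal{L}\{\tau;s\}=\int_0^\infty\tau(x)e^{-sx}\,\mathrm{d}x$ for $\Re e\, s>0$. Suppose that one of the following two conditions holds: (T.1) $\tau$ is boundedly decreasing; (T.2) there are $x_0\geq0$ and $\beta\in\mathbb{R}$ such that $e^{\beta x}\tau(x)$ is non-negative and non-decreasing on $[x_0,\infty)$. If $\mathcal{L}\{\tau;s\}$ has pseudomeasure boundary behavior at $s=0$, then $\tau(x)=O(1)$ as $x\to\infty$.
   Context: A real-valued function $\tau$ is boundedly decreasing if there is $\delta>0$ with $\liminf_{x\to\infty}\inf_{h\in[0,\delta]}(\tau(x+h)-\tau(x))>-\infty$; a complex-valued function is boundedly decreasing if its real and imaginary parts are. The Fourier transform is $\hat\varphi(t)=\int e^{-itx}\varphi(x)\,\mathrm{d}x$, extended to tempered distributions by duality. A tempered distribution $f$ is a pseudomeasure if $\hat f\in L^\infty(\mathbb{R})$. A distribution $f$ is a local pseudomeasure at $t_0$ if $f$ coincides with a pseudomeasure on some open neighborhood of $t_0$. An analytic function $F$ on $\Re e\, s>0$ has pseudomeasure boundary behavior at the point $it_0$ if there is an open interval $U\ni t_0$ such that $F(\sigma+it)$ converges in $\mathcal{D}'(U)$ as $\sigma\to0^+$ to a distribution that is a local pseudomeasure at every point of $U$. *)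

(* Defs.v *)
From HB Require Import structures.
From mathcomp Require Import all_boot all_order all_algebra.
From mathcomp Require Import all_classical all_reals all_analysis.
From mathcomp Require Import complex.
Set Implicit Arguments. Unset Strict Implicit. Unset Printing Implicit Defensive.
Import Order.TTheory GRing.Theory Num.Theory.
Import numFieldNormedType.Exports.
Local Open Scope classical_set_scope.
Local Open Scope ring_scope.
Local Open Scope complex_scope.

Section Defs.
Variable R : realType.
Local Notation C := R[i].
Local Notation mu := (@lebesgue_measure R).

Definition cRe (z : C) : R := complex.Re z.
Definition cIm (z : C) : R := complex.Im z.

Definition cexp (z : C) : C :=
  (expR (cRe z) * cos (cIm z)) +i* (expR (cRe z) * sin (cIm z)).

Definition cint (D : set R) (f : R -> C) : C :=
  (Rintegral mu D (cRe \o f)) +i* (Rintegral mu D (cIm \o f)).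

Definition L1loc (f : R -> C) : Prop :=
  forall a b : R,
    mu.-integrable `[a, b] (EFin \o (cRe \o f)) /\
    mu.-integrable `[a, b] (EFin \o (cIm \o f)).

Definition laplace_partial (tau : R -> C) (s : C) (T : R) : C :=
  cint `[0, T] (fun x => tau x * cexp (- (s * x%:C))).

Definition laplace_converges (tau : R -> C) (s : C) : Prop :=
  cvg ((fun T => cRe (laplace_partial tau s T)) @ +oo) /\
  cvg ((fun T => cIm (laplace_partial tau s T)) @ +oo).

Definition laplaceT (tau : R -> C) (s : C) : C :=
  (lim ((fun T => cRe (laplace_partial tau s T)) @ +oo)) +i*
  (lim ((fun T => cIm (laplace_partial tau s T)) @ +oo)).

(* boundedly decreasing, real-valued:
   exists delta > 0, liminf_{x -> oo} inf_{h in [0,delta]} (f(x+h) - f(x)) > -oo *)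
Definition bdd_decreasingR (f : R -> R) : Prop :=
  exists2 delta : R, 0 < delta &
    exists M : R, \forall x \near +oo,
      forall h : R, 0 <= h <= delta -> - M <= f (x + h) - f x.

Definition bdd_decreasing (f : R -> C) : Prop :=
  bdd_decreasingR (cRe \o f) /\ bdd_decreasingR (cIm \o f).

Definition smoothR (f : R -> R) : Prop :=
  forall (n : nat) (x : R), derivable (iter n (@derive1 R R) f) x 1.

Definition cderiv (f : R -> C) : R -> C :=
  fun x => (derive1 (cRe \o f) x) +i* (derive1 (cIm \o f) x).

Definition cderivn (n : nat) (f : R -> C) : R -> C := iter n cderiv f.

Definition csmooth (f : R -> C) : Prop :=
  smoothR (cRe \o f) /\ smoothR (cIm \o f).

Definition test_fun (V : set R) (phi : R -> C) : Prop :=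
  csmooth phi /\
  exists K : set R, [/\ compact K, K `<=` V & forall x, ~ K x -> phi x = 0].

Definition schwartz (phi : R -> C) : Prop :=
  csmooth phi /\
  forall k n : nat, exists M : R, forall x : R,
    `| (x ^+ k)%:C * cderivn n phi x | <= M%:C.

Definition tempered (P : (R -> C) -> C) : Prop :=
  (forall (a : C) (phi psi : R -> C), schwartz phi -> schwartz psi ->
     P (fun x => a * phi x + psi x) = a * P phi + P psi) /\
  exists (K : R) (N : nat), forall phi, schwartz phi ->
    forall M : R,
      (forall k n : nat, (k <= N)%N -> (n <= N)%N -> forall x : R,
          `| (x ^+ k)%:C * cderivn n phi x | <= M%:C) ->
      `| P phi | <= (K * M)%:C.

Definition fourierT (phi : R -> C) : R -> C :=
  fun t => cint setT (fun x => cexp (0 +i* (- (t * x))) * phi x).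

Definition Linfty (h : R -> C) : Prop :=
  measurable_fun setT (cRe \o h) /\ measurable_fun setT (cIm \o h) /\
  exists M : R, {ae mu, forall x, `| h x | <= M%:C}.

(* pseudomeasure: tempered distribution whose Fourier transform (defined by
   duality <hat P, psi> = <P, hat psi>) is an L^oo function *)
Definition pseudomeasure (P : (R -> C) -> C) : Prop :=
  tempered P /\
  exists h : R -> C, Linfty h /\
    forall psi, schwartz psi -> P (fourierT psi) = cint setT (fun x => h x * psi x).

Definition local_pseudomeasure (U : set R) (g : (R -> C) -> C) (t0 : R) : Prop :=
  exists V : set R, [/\ open V, V t0, V `<=` U &
    exists P, pseudomeasure P /\ forall phi, test_fun V phi -> g phi = P phi].

Definition pm_boundary (F : C -> C) (t0 : R) : Prop :=
  exists a b : R, a < t0 < b /\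
  exists g : (R -> C) -> C,
    (forall phi, test_fun `]a, b[ phi ->
       ((fun sigma => cRe (cint setT (fun t => F (sigma +i* t) * phi t)))
          @ 0^'+ --> cRe (g phi)) /\
       ((fun sigma => cIm (cint setT (fun t => F (sigma +i* t) * phi t)))
          @ 0^'+ --> cIm (g phi))) /\
    (forall t, a < t < b -> local_pseudomeasure `]a, b[ g t).

End Defs.

(* Main.v *)
(* Let [K >= 0] be the Fourier transform of a bump function [phi = chi * chi]
   supported near [0], so that [K] is the square of the transform of [chi].
   - Either Tauberian condition bounds [tau] below by a linear function, and then
     convergence of the improper Laplace integral at [s > 0] forces absolute
     convergence (Fatou).
   - By Fubini, pairing [L(s + it)] with [phi(t) e^{ixt}] gives the mean of
     [tau(u) e^{-su}] against [K(u - x)].  As [s -> 0+] it tends to the value of a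
     pseudomeasure at [phi(t) e^{ixt}], which by Fourier inversion is the transform
     of a translate of [K]; it is therefore bounded uniformly in [x] by the sup norm
     of the pseudomeasure's transform times the L^1 norm of [K].  Fatou's lemma
     removes the factor [e^{-su}].
   - If [- l <= tau] to the left of [x], the bounded mean centred to the right of [x]
     gives [tau x <= C + l / 4], and the one centred to the left then gives
     [- tau x <= C' + l / 2]; taking suprema, [l] is bounded.  Under the second
     condition [tau >= 0], and the mean centred just to the right of [x] already
     dominates a multiple of [tau x]. *)
Require Import Defs.
From HB Require Import structures.
From mathcomp Require Import all_boot all_order all_algebra.
From mathcomp Require Import all_classical all_reals all_analysis.
From mathcomp Require Import complex.
From mathcomp Require Import measurable_realfun ring lra.
Import Order.TTheory GRing.Theory Num.Theory.
Import numFieldNormedType.Exports.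
Local Open Scope classical_set_scope.
Local Open Scope ring_scope.
Local Open Scope complex_scope.
(** * Integration on the real line *)

Section Calc.
Context {R : realType}.
Implicit Types (f g p : R -> R).
Local Notation mu := (@lebesgue_measure R).

(** Everything is done with real integrals, one component of [tau] at a time. This is possible
    because the bump is even: its transform [K] is then real, and the real and imaginary parts of
    the pairing with [phi(t) e^{ixt}] see only the real and imaginary parts of [tau]. Non-negativity
    of [K] is used twice: one-sided bounds on [tau] survive integration against it, and Fatou's
    lemma applies. Since [phi] has compact support, [K] cannot have it, so every mean sees the whole
    line. Bounded decrease controls [tau] over long distances only up to a linear error; the rapid
    decay of [K] makes its first moment finite and absorbs that error. What remains is the mass on
    the wrong side of [x], kept below [Int K / 8] by moving the centre by [A]. The value 1/8 only
    has to leave a coefficient of [l] below 1 after both comparisons, so that the inequality for the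
    supremum closes. That supremum runs over a half-line ending at [x], where it is finite for a
    soft reason, and the resulting bound does not depend on [x]. *)

Definition intble f := mu.-integrable setT (EFin \o f).

Definition Int f : R := \int[mu]_x f x.

Lemma intble_meas f : intble f -> measurable_fun setT f.
Proof. by move=> /integrableP[/measurable_EFinP]. Qed.

Lemma intble_le f g : measurable_fun setT f -> intble g ->
  (forall x, `|f x| <= g x) -> intble f.
Proof.
move=> mf ig fg; apply: (le_integrable _ _ _ ig) => //; first exact/measurable_EFinP.
by move=> x _ /=; rewrite lee_fin (le_trans (fg x))// ler_norm.
Qed.

Lemma intbleD f g : intble f -> intble g -> intble (fun x => f x + g x).
Proof. by move=> jf jg; have := integrableD measurableT jf jg. Qed.

Lemma intbleZ (r : R) f : intble f -> intble (fun x => r * f x).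
Proof. by move=> jf; have := integrableZl measurableT r jf. Qed.

Lemma intbleN f : intble f -> intble (fun x => - f x).
Proof. by move=> /(intbleZ (-1)); apply: eq_integrable => // x _ /=; rewrite mulN1r. Qed.

Lemma intbleB f g : intble f -> intble g -> intble (fun x => f x - g x).
Proof. by move=> jf jg; apply: intbleD => //; exact: intbleN. Qed.

Lemma intble_norm f : intble f -> intble (fun x => `|f x|).
Proof. by move=> jf; have := integrable_norm jf. Qed.

Lemma intbleM (M : R) f g : intble f -> measurable_fun setT g ->
  (forall x, `|g x| <= M) -> intble (fun x => f x * g x).
Proof.
move=> jf mg gM; apply: (@intble_le _ (fun x => M * `|f x|)).
- by apply: measurable_funM => //; exact: intble_meas.
- exact/intbleZ/intble_norm.
- by move=> x; rewrite normrM mulrC ler_wpM2r.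
Qed.

Lemma Int_eq f g : f =1 g -> Int f = Int g.
Proof. by move=> /funext ->. Qed.

Lemma Int_0 : Int (fun=> 0) = 0.
Proof. by rewrite /Int /Rintegral integral0. Qed.

Lemma Int_D f g : intble f -> intble g -> Int (fun x => f x + g x) = Int f + Int g.
Proof. by move=> jf jg; exact: RintegralD. Qed.

Lemma Int_B f g : intble f -> intble g -> Int (fun x => f x - g x) = Int f - Int g.
Proof. by move=> jf jg; exact: RintegralB. Qed.

Lemma Int_Z (r : R) f : intble f -> Int (fun x => r * f x) = r * Int f.
Proof. by move=> jf; exact: RintegralZl. Qed.

Lemma Int_N f : intble f -> Int (fun x => - f x) = - Int f.
Proof. by move=> /(Int_Z (-1)); rewrite mulN1r => <-; apply: Int_eq => x; rewrite mulN1r. Qed.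

Lemma Int_le f g : intble f -> intble g -> (forall x, f x <= g x) -> Int f <= Int g.
Proof. by move=> jf jg fg; apply: le_Rintegral. Qed.

Lemma Int_ge0 f : (forall x, 0 <= f x) -> 0 <= Int f.
Proof. by move=> f0; apply: Rintegral_ge0. Qed.

Lemma Int_bound f g : intble f -> intble g -> (forall x, `|f x| <= g x) -> `|Int f| <= Int g.
Proof.
move=> jf jg fg; apply: le_trans (le_normr_Rintegral _ jf) _ => //.
by apply: Int_le => //; exact: intble_norm.
Qed.

Lemma Int_EFin f : intble f -> (Int f)%:E = (\int[mu]_x (f x)%:E)%E.
Proof. by move=> jf; rewrite /Int /Rintegral fineK//; exact: integrable_fin_num. Qed.

Lemma Int_dct (f_ : nat -> R -> R) f g : (forall n, measurable_fun setT (f_ n)) ->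
  (forall x, f_ ^~ x @ \oo --> f x) -> intble g ->
  (forall n x, `|f_ n x| <= g x) ->
  intble f /\ (fun n => Int (f_ n)) @ \oo --> Int f.
Proof.
move=> mf cf jg bg.
have mlim : measurable_fun setT f by apply: (measurable_fun_cvg mf) => x _; exact: cf.
have [] := @dominated_convergence _ _ _ mu _ measurableT (fun n => EFin \o f_ n)
   (EFin \o f) (EFin \o g).
- by move=> n; apply/measurable_EFinP; exact: mf.
- by apply/measurable_EFinP; exact: mlim.
- apply: aeW => x _; apply: (@cvg_EFin _ _ _ _ (fun n => (f_ n x)%:E) (f x)) => /=.
    exact: nearW.
  exact: cf.
- by [].
- by apply: aeW => x n _ /=; rewrite lee_fin.
move=> jf _ cI; split=> //.
have jfn n : intble (f_ n) by apply: intble_le (mf n) jg _.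
by move: cI; rewrite -(Int_EFin _ jf) => /fine_cvg.
Qed.

Lemma Int_fatou (f_ : nat -> R -> R) f (B : R) : (forall n, intble (f_ n)) ->
  (forall n x, 0 <= f_ n x) -> (forall x, f_ ^~ x @ \oo --> f x) ->
  (forall n, Int (f_ n) <= B) -> intble f.
Proof.
move=> jf f0 cf IB.
have mf : measurable_fun setT f.
  by apply: (measurable_fun_cvg (fun n => intble_meas _ (jf n))) => x _; exact: cf.
have fge0 x : 0 <= f x.
  by apply: (cvgr_to_ge (cf x)); exact: nearW.
apply/integrableP; split; first exact/measurable_EFinP.
have := @fatou _ _ _ mu _ measurableT (fun n => EFin \o f_ n).
move=> /(_ (fun n => (measurable_EFinP _ _).2 (intble_meas _ (jf n)))).
move=> /(_ (fun n x _ => f0 n x)).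
have E x : (limn_einf (fun n => (f_ n x)%:E) = `|(f x)%:E|)%E.
  rewrite /= ger0_norm//.
  have cfx : (fun n => (f_ n x)%:E) @ \oo --> (f x)%:E.
    by apply: cvg_EFin; [exact: nearW|exact: cf].
  by rewrite is_cvg_limn_einfE; [exact/cvg_lim|apply/cvg_ex; eexists; exact: cfx].
under eq_integral do rewrite /= E.
move=> /le_lt_trans; apply.
apply: (@le_lt_trans _ _ B%:E); last exact: ltry.
rewrite limn_einf_lim; apply: lime_le; first exact: is_cvg_einfs.
apply: nearW => n; apply: le_trans (ereal_inf_lbound _) _; first by exists n => /=.
by rewrite -Int_EFin// lee_fin.
Qed.

(* A summability method [w_] whose means of [f] converge already forces absolute
   integrability when [f] is bounded below by an integrable function. *)
Lemma Int_one_sided (w_ : nat -> R -> R) f p (l : R) :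
  (forall n, measurable_fun setT (w_ n)) -> (forall n x, 0 <= w_ n x <= 1) ->
  (forall x, w_ ^~ x @ \oo --> (1 : R)) ->
  measurable_fun setT f -> intble p -> (forall x, 0 <= p x) ->
  (forall x, - p x <= f x) ->
  (forall n, intble (fun x => f x * w_ n x)) ->
  (fun n => Int (fun x => f x * w_ n x)) @ \oo --> l ->
  intble f /\ Int f = l.
Proof.
move=> mw w01 cw mf jp p0 fp jfw cI.
have cfw x : (fun n => f x * w_ n x) @ \oo --> f x.
  by rewrite -[X in _ --> X]mulr1; apply: cvgM; [exact: cvg_cst|exact: cw].
have [B IB] : exists B, forall n, Int (fun x => f x * w_ n x) <= B.
  have : cvgn (fun n => Int (fun x => f x * w_ n x)) by apply/cvg_ex; exists l.
  move=> /cvg_seq_bounded/bounded_fun_has_ubound[B Bub].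
  by exists B => n; apply: Bub; exists n.
have jfp : intble (fun x => f x + p x).
  apply: (@Int_fatou (fun n x => f x * w_ n x + p x) _ (B + Int p)).
  - by move=> n; exact: intbleD.
  - move=> n x; have /andP[w0 w1] := w01 n x.
    have := p0 x; have := fp x; nra.
  - by move=> x; apply: cvgD => //; exact: cvg_cst.
  - by move=> n; rewrite Int_D// lerD2r.
have jf : intble f.
  have := intbleB _ _ jfp jp; apply: eq_integrable => // x _ /=.
  by rewrite addrK.
split=> //.
have fw n x : `|f x * w_ n x| <= `|f x|.
  rewrite normrM ler_piMr//; have /andP[w0 w1] := w01 n x.
  by rewrite ger0_norm.
have [_ cJ] := Int_dct _ _ _ (fun n => intble_meas _ (jfw n)) cfw (intble_norm _ jf) fw.
exact: cvg_unique cJ cI.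
Qed.

(** By Tonelli, a product majorant gives joint integrability; all double integrals below have
    one. *)
Lemma Int_fubini (f : R -> R -> R) (a b : R -> R) :
  measurable_fun setT (fun z : R * R => f z.1 z.2) -> intble a -> intble b ->
  (forall x y, `|f x y| <= a x * b y) ->
  Int (fun x => Int (f x)) = Int (fun y => Int (fun x => f x y)).
Proof.
move=> mf ja jb fab.
have m1 x : measurable_fun setT (f x).
  by have := measurableT_comp mf (pair1_measurable x).
have m2 y : measurable_fun setT (f ^~ y).
  by have := measurableT_comp mf (pair2_measurable y).
have jx x : intble (f x).
  by apply: (@intble_le _ (fun y => a x * b y)) => //; exact: intbleZ.
have jy y : intble (f ^~ y).
  apply: (@intble_le _ (fun x => b y * a x)) => //; first exact: intbleZ.
  by move=> x; rewrite mulrC.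
have jf : (mu \x mu)%E.-integrable setT (fun z : R * R => (f z.1 z.2)%:E).
  apply/integrable12ltyP; first exact/measurable_EFinP.
  apply: (@le_lt_trans _ _ (\int[mu]_x ((a x)%:E * (Int b)%:E))%E).
    apply: ge0_le_integral => //.
    - by move=> x _; exact: integral_ge0.
    - apply: (@measurable_fun_fubini_tonelli_F _ _ _ _ R mu
        (fun z : R * R => `|(f z.1 z.2)%:E|%E)) => //.
      by apply: measurableT_comp => //; apply/measurable_EFinP; exact: mf.
    - by apply/measurable_EFinP/measurable_funM => //; exact: intble_meas.
    move=> x _; rewrite -EFinM -Int_Z// Int_EFin; last exact: intbleZ.
    apply: ge0_le_integral => //.
    - by apply: measurableT_comp => //; apply/measurable_EFinP; exact: m1.
    - by apply/measurable_EFinP/measurable_funM => //; exact: intble_meas.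
    - by move=> y _ /=; rewrite lee_fin.
  under eq_integral do rewrite -EFinM mulrC.
  by rewrite -Int_EFin ?ltry//; exact: intbleZ.
rewrite /Int /Rintegral; congr fine.
transitivity (\int[mu]_x \int[mu]_y (f x y)%:E)%E.
  by apply: eq_integral => x _; rewrite -Int_EFin.
rewrite (Fubini jf)/=.
by apply: eq_integral => x _; rewrite -(Int_EFin _ (jy x)).
Qed.

Lemma Int_derive (f f' : R -> R -> R) (G : R -> R) :
  (forall x, intble (f x)) ->
  (forall x y, is_derive x (1 : R) (f ^~ y) (f' x y)) ->
  (forall x y, `|f' x y| <= G y) -> intble G ->
  forall x, is_derive x (1 : R) (fun x => Int (f x)) (Int (f' x)).
Proof.
move=> jf df bf jG x.
have E z y : partial1of2 f z y = f' z y by rewrite partial1of2E derive_val.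
have xI : `]x - 1, x + 1[%classic x by rewrite /= in_itv/=; lra.
have G0 y : 0 <= G y by exact: le_trans (bf x y).
have H1 z y : `]x - 1, x + 1[%classic z -> setT y -> derivable (f^~ y) z 1 by [].
have H2 z y : `]x - 1, x + 1[%classic z -> setT y -> `|partial1of2 f z y| <= G y.
  by move=> _ _; rewrite E.
have D := @derivable_under_integral _ _ _ mu f _ measurableT x _ _ xI
  (fun z _ => jf z) H1 G G0 jG H2.
apply: DeriveDef => //.
rewrite -derive1E (@differentiation_under_integral _ _ _ mu f _ measurableT x _ _ xI
  (fun z _ => jf z) H1 G G0 jG H2).
by apply: eq_Rintegral => y _; rewrite E.
Qed.

(** The pushforward of Lebesgue measure under [F] agrees with it on half-open intervals, hence
    everywhere by uniqueness. Translations and the reflection are the two instances. *)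
Lemma Int_comp (F : R -> R) f : measurable_fun setT F ->
  (forall a b : R, a < b -> mu (F @^-1` `]a, b]%classic) = mu `]a, b]%classic) ->
  intble (f \o F) -> measurable_fun setT f -> intble f /\ Int (f \o F) = Int f.
Proof.
move=> mF H jf mf.
pose F' : measurableTypeR R -> measurableTypeR R := F.
have mF' : measurable_fun setT F' by exact: mF.
pose nu := measure_function_pushforward__canonical__measure_function_Measure mu mF'.
have H2 A : measurable A -> mu A = nu A.
  move: A; apply: lebesgue_measure_unique.
  by move=> X /ocitvP[->|[[a b] /= ab ->]]; [rewrite !measure0|rewrite -H].
have mf' : measurable_fun (T:=measurableTypeR R) setT (EFin \o f).
  by apply/measurable_EFinP; exact: mf.
have jf' := integrable_pushforward mF' mf' jf measurableT.
have E := integral_pushforward mF' mf' jf measurableT.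
split.
  apply/integrableP; split; first exact: mf'.
  move/integrableP : jf' => [_].
  by rewrite (eq_measure_integral mu)// => A mA _; rewrite -H2.
rewrite /Int /Rintegral -E; congr fine.
by apply: eq_measure_integral => A mA _; rewrite -H2.
Qed.

Lemma Int_shift (c : R) f : intble f ->
  intble (fun x => f (x + c)) /\ Int (fun x => f (x + c)) = Int f.
Proof.
move=> jf.
have H d : forall a b : R, a < b ->
    mu ((fun x => x + d) @^-1` `]a, b]%classic) = mu `]a, b]%classic.
  move=> a b ab.
  rewrite (_ : _ @^-1` _ = `]a - d, b - d]%classic); last first.
    by apply/seteqP; split=> x /=; rewrite !in_itv/= ltrBlDr lerBrDr.
  by rewrite !lebesgue_measure_itv/= !lte_fin ltrD2r ab -!EFinB opprD opprK addrACA addNr addr0.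
have mS d : measurable_fun setT (fun x : R => x + d) by exact: measurable_funD.
(* [Int_comp] is applied to the translated function, since integrability is known only after
   composing back to [f]. *)
have E : (fun x => f (x + c)) \o (fun x => x - c) = f.
  by apply/funext => x /=; rewrite subrK.
have mfc : measurable_fun setT (fun x : R => f (x + c)).
  by apply: (@measurableT_comp _ _ _ _ _ _ f) => //; exact: intble_meas.
have [|//|? <-] := @Int_comp (fun x => x - c) (fun x => f (x + c)) (mS _) (H _).
  by rewrite E.
by rewrite E.
Qed.

Lemma continuous_meas f : continuous f -> measurable_fun setT f.
Proof. exact: continuous_measurable_fun. Qed.

Lemma Int_reflect f : intble f ->
  intble (fun x => f (- x)) /\ Int (fun x => f (- x)) = Int f.
Proof.
move=> jf.
have H : forall a b : R, a < b -> mu (-%R @^-1` `]a, b]%classic) = mu `]a, b]%classic.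
  move=> a b ab.
  rewrite (_ : _ @^-1` _ = `[- b, - a[%classic); last first.
    by apply/seteqP; split=> x /=; rewrite !in_itv/= andbC ltrNr lerNl.
  by rewrite !lebesgue_measure_itv/= !lte_fin ltrN2 ab -!EFinB opprK addrC.
have E : (fun x => f (- x)) \o -%R = f by apply/funext => x /=; rewrite opprK.
have mfc : measurable_fun setT (fun x : R => f (- x)).
  by apply: (@measurableT_comp _ _ _ _ _ _ f) => //; exact: intble_meas.
have mN : measurable_fun setT (-%R : R -> R) by apply: continuous_meas; exact: opp_continuous.
have [|//|? <-] := Int_comp -%R (fun x => f (- x)) mN H.
  by rewrite E.
by rewrite E.
Qed.

Lemma Int_odd f : intble f -> (forall x, f (- x) = - f x) -> Int f = 0.
Proof.
move=> jf fN; have [_ H] := Int_reflect _ jf.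
have : Int (fun x => f (- x)) = - Int f by rewrite -Int_N//; exact: Int_eq.
by rewrite H; lra.
Qed.

Lemma ge0_intble f (c : R) : measurable_fun setT f -> (forall x, 0 <= f x) ->
  (\int[mu]_x (f x)%:E = c%:E)%E -> intble f.
Proof.
move=> mf f0 fc; apply/integrableP; split; first exact/measurable_EFinP.
under eq_integral do rewrite /= ger0_norm//.
by rewrite fc ltry.
Qed.

(** * Explicit integrals of two-sided exponentials *)

Lemma continuous_expN (e : R) : continuous (fun x : R => expR (- (e * `|x|))).
Proof.
move=> x.
apply: (@continuous_comp _ _ _ (fun x => - (e * `|x|)) expR); last exact: continuous_expR.
apply: continuousN; apply: continuousM; first exact: cvg_cst.
exact: norm_continuous.
Qed.

Lemma continuous_cosM (s : R) : continuous (fun x : R => cos (s * x)).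
Proof.
move=> x; apply: (@continuous_comp _ _ _ (fun x => s * x) cos); last exact: continuous_cos.
by apply: continuousM => //; exact: cvg_cst.
Qed.

Lemma continuous_sinM (s : R) : continuous (fun x : R => sin (s * x)).
Proof.
move=> x; apply: (@continuous_comp _ _ _ (fun x => s * x) sin); last exact: continuous_sin.
by apply: continuousM => //; exact: cvg_cst.
Qed.

Lemma cvg_expN_bounded (e M : R) (B : R -> R) : 0 < e -> (forall x, `|B x| <= M) ->
  expR (- (e * x)) * B x @[x --> +oo] --> (0 : R).
Proof.
move=> e0 BM.
have ce : expR (- (e * x)) @[x --> +oo] --> (0 : R).
  apply: (@cvg_comp _ _ _ (fun x => e * x) (fun y => expR (- y)) _ (+oo%R)); last exact: cvgr_expR.
  exact: gt0_cvgMry.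
apply: norm_cvg0.
apply: (@squeeze_cvgr _ _ _ _ (cst 0) (fun x => M * expR (- (e * x)))).
- by apply: nearW => x; rewrite /= normr_ge0 normrM ger0_norm ?expR_ge0// mulrC ler_wpM2r// expR_ge0.
- exact: cvg_cst.
- by rewrite -(mulr0 M); apply: cvgM => //; exact: cvg_cst.
Qed.

(** The summand 1 makes the integrand non-negative, so the fundamental theorem on a half-line
    applies without prior integrability. The case [s = 0] gives the plain exponential, and
    subtracting it gives the cosine integral. *)
Lemma Int_expN_1cos (e s : R) : 0 < e ->
  (\int[mu]_x (expR (- (e * `|x|)) * (1 + cos (s * x)))%:E = (2 * (e^-1 + e / (e ^+ 2 + s ^+ 2)))%:E)%E.
Proof.
move=> e0.
have es : e ^+ 2 + s ^+ 2 != 0 by rewrite gt_eqF// ltr_pwDl ?exprn_gt0// sqr_ge0.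
have en : e != 0 by rewrite gt_eqF.
have c1 (y : R) : 0 <= 1 + cos y by have := cos_geN1 y; lra.
rewrite ge0_symfun_integralT; first 1 last.
- by move=> x; rewrite mulr_ge0// expR_ge0.
- have cc : continuous (fun x : R => expR (- (e * `|x|)) * (1 + cos (s * x))).
    move=> x; apply: cvgM; first exact: continuous_expN.
    by apply: cvgD; [exact: cvg_cst|exact: continuous_cosM].
  exact: cc.
- by move=> x /=; rewrite normrN mulrN cosN.
rewrite -set_itvcy.
(* An antiderivative on the half-line that tends to 0 at infinity, so the half-line integral is
   [- F 0]. *)
pose F (x : R) := expR (- (e * x)) * (- e^-1 + (e ^+ 2 + s ^+ 2)^-1 * (s * sin (s * x) - e * cos (s * x))).
have dF (x : R) : is_derive x (1 : R) F (expR (- (e * x)) * (1 + cos (s * x))).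
  rewrite /F; apply: is_derive_eq.
  by rewrite /GRing.scale/=; field; apply/andP.
rewrite (_ : integral _ _ _ =
  (\int[mu]_(x in `[0%R, +oo[) (expR (- (e * x)) * (1 + cos (s * x)))%:E)%E); last first.
  by apply: eq_integral => x; rewrite inE/= in_itv/= andbT => x0; rewrite ger0_norm.
rewrite (@ge0_continuous_FTC2y _ _ F 0 0).
- by rewrite -EFinB -EFinM /F !mulr0 oppr0 expR0 sin0 cos0; congr EFin; field; apply/andP.
- by move=> x _; rewrite mulr_ge0// expR_ge0.
- have cc : continuous (fun x : R => expR (- (e * x)) * (1 + cos (s * x))).
    by move=> x; apply: differentiable_continuous; exact/derivable1_diffP.
  by apply: continuous_subspaceT => x; exact: cc.
- apply: (@cvg_expN_bounded e (e^-1 + (e ^+ 2 + s ^+ 2)^-1 * (`|s| + e))) => // x.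
  have p0 : 0 <= (e ^+ 2 + s ^+ 2)^-1 by rewrite invr_ge0 addr_ge0// sqr_ge0.
  apply: (le_trans (ler_normD _ _)); rewrite normrN gtr0_norm ?invr_gt0// lerD2l.
  rewrite normrM (ger0_norm p0) ler_wpM2l//.
  apply: (le_trans (ler_normB _ _)); rewrite !normrM (gtr0_norm e0) lerD//.
    by rewrite ler_piMr// sin_max.
  by rewrite ler_piMr ?cos_max// ltW.
- by [].
- apply: cvg_at_right_filter; apply: differentiable_continuous.
  exact/derivable1_diffP.
- by move=> x _; rewrite derive1E derive_val.
Qed.

Lemma Int_expN (e : R) : 0 < e ->
  intble (fun x => expR (- (e * `|x|))) /\ Int (fun x => expR (- (e * `|x|))) = 2 / e.
Proof.
move=> e0.
have E (x : R) : expR (- (e * `|x|)) = 2^-1 * (expR (- (e * `|x|)) * (1 + cos (0 * x))).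
  by rewrite mul0r cos0; lra.
have j : intble (fun x => expR (- (e * `|x|)) * (1 + cos (0 * x))).
  apply: (ge0_intble _ (2 * (e^-1 + e / (e ^+ 2 + 0 ^+ 2)))) (Int_expN_1cos _ _ e0).
    apply: measurable_funM; first by apply: continuous_meas; exact: continuous_expN.
    by apply: measurable_funD => //; apply: continuous_meas; exact: continuous_cosM.
  by move=> x; rewrite mul0r cos0 mulr_ge0// expR_ge0.
split.
  by have := intbleZ 2^-1 _ j; apply: eq_integrable => // x _ /=; rewrite -E.
rewrite (Int_eq _ _ E) Int_Z// /Int /Rintegral Int_expN_1cos//= expr0n/= addr0.
by field; rewrite gt_eqF.
Qed.

Lemma Int_expN_cos (e s : R) : 0 < e ->
  Int (fun x => expR (- (e * `|x|)) * cos (s * x)) = 2 * e / (e ^+ 2 + s ^+ 2).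
Proof.
move=> e0; have [je Ie] := Int_expN e e0.
have jc : intble (fun x => expR (- (e * `|x|)) * cos (s * x)).
  apply: (intbleM 1) => //; first by apply: continuous_meas; exact: continuous_cosM.
  by move=> x; rewrite cos_max.
have : Int (fun x => expR (- (e * `|x|)) * (1 + cos (s * x))) = 2 * (e^-1 + e / (e ^+ 2 + s ^+ 2)).
  by rewrite /Int /Rintegral Int_expN_1cos.
rewrite (Int_eq _ (fun x => expR (- (e * `|x|)) + expR (- (e * `|x|)) * cos (s * x))).
  by rewrite Int_D// Ie => H; apply: (addrI (2 / e)); rewrite H mulrDr mulrA.
by move=> x; rewrite mulrDr mulr1.
Qed.

Lemma Int_lower_bound f (r c : R) : intble f -> 0 <= r -> (forall x, 0 <= f x) ->
  (forall x, `|x| <= r -> c <= f x) -> c * (r *+ 2) <= Int f.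
Proof.
move=> jf r0 f0 cf.
have mi : measurable_fun setT (\1_(`[- r, r]%classic : set R) : R -> R).
  by apply: measurable_indic.
have ji : intble (\1_(`[- r, r]%classic : set R) : R -> R).
  apply: (ge0_intble _ (r *+ 2)) => //.
  transitivity (mu `[- r, r]%classic); first by rewrite integral_indic// setIT.
  rewrite lebesgue_measure_itv/= lte_fin.
  by case: ltP => h /=; rewrite -?EFinB; congr EFin; lra.
have -> : c * (r *+ 2) = Int (fun x => c * \1_(`[- r, r]%classic : set R) x).
  rewrite Int_Z//; congr (c * _); rewrite /Int /Rintegral.
  rewrite (_ : integral _ _ _ = mu `[- r, r]%classic); last by rewrite integral_indic// setIT.
  rewrite lebesgue_measure_itv/= lte_fin.
  by case: ltP => h /=; [rewrite opprK mulr2n|lra].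
apply: Int_le => // [|x]; first exact: intbleZ.
rewrite indicE; case: (boolP (x \in _)) => [|_]; last by rewrite mulr0.
by rewrite inE/= in_itv/= -ler_norml mulr1 => /cf.
Qed.

Lemma intble_decay f (M : R) : measurable_fun setT f ->
  (forall x, (1 + x ^+ 2) * `|f x| <= M) -> intble f.
Proof.
move=> mf fM.
have E x : oneDsqr x = 1 + x ^+ 2 :> R by [].
have j : intble (fun x => (oneDsqr x)^-1).
  apply: (ge0_intble _ (2 * (pi / 2))).
  - by apply: continuous_meas; exact: continuous_oneDsqrV.
  - by move=> x; rewrite invr_ge0.
  rewrite ge0_symfun_integralT.
  - by rewrite -set_itvcy integral0y_oneDsqr -EFinM.
  - by move=> x; rewrite invr_ge0.
  - exact: continuous_oneDsqrV.
  - by move=> x /=; rewrite !E sqrrN.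
apply: intble_le (intbleZ M _ j) _ => // x.
rewrite ler_pdivlMr ?E ?ltr_pwDl ?sqr_ge0// mulrC; exact: fM.
Qed.

End Calc.
(** * Smooth functions *)

Section Smooth.
Context {R : realType}.
Implicit Types (f g : R -> R).

(** Coinduction for smoothness: a class of derivable functions stable under [derive1] contains all
    iterated derivatives of its members. *)
Lemma smooth_coind (S : (R -> R) -> Prop) :
  (forall f, S f -> (forall x, derivable f x 1) /\ S (derive1 f)) ->
  forall f, S f -> smoothR f.
Proof.
move=> H f Sf n; suff : S (iter n (@derive1 R R) f) by move=> /H[].
by elim: n => [//|n IH]; rewrite iterS; have [] := H _ IH.
Qed.

Lemma smooth_derivable f : smoothR f -> forall x, derivable f x 1.
Proof. by move=> sf x; exact: (sf 0%N). Qed.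

Lemma smooth_derive1 f : smoothR f -> smoothR (derive1 f).
Proof. by move=> sf n x; have := sf n.+1 x; rewrite iterSr. Qed.

Lemma smooth_is_derive f : smoothR f -> forall x, is_derive x (1 : R) f (derive1 f x).
Proof. by move=> sf x; apply: DeriveDef; [exact: smooth_derivable|rewrite derive1E]. Qed.

Lemma derivable_continuous f : (forall x, derivable f x 1) -> continuous f.
Proof. by move=> df x; apply: differentiable_continuous; exact/derivable1_diffP. Qed.

Lemma smooth_continuous f : smoothR f -> continuous f.
Proof. by move=> /smooth_derivable/derivable_continuous. Qed.

(** The product rule leads out of most natural families but not out of the ring they generate. It is
    therefore enough to differentiate the generators and find the result in that ring. *)
Inductive ring_gen (S : (R -> R) -> Prop) : (R -> R) -> Prop :=
| gen_base f : S f -> ring_gen S f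
| gen_add f g : ring_gen S f -> ring_gen S g -> ring_gen S (fun x => f x + g x)
| gen_mul f g : ring_gen S f -> ring_gen S g -> ring_gen S (fun x => f x * g x).

Lemma smooth_ring_gen (S : (R -> R) -> Prop) :
  (forall f, S f -> exists2 f', forall x, is_derive x (1 : R) f (f' x) & ring_gen S f') ->
  forall f, ring_gen S f -> smoothR f.
Proof.
move=> H; apply: smooth_coind => f Gf.
suff [f' df Gf'] : exists2 f', forall x, is_derive x (1 : R) f (f' x) & ring_gen S f'.
  split=> [x|]; first by have [] := df x.
  rewrite (_ : derive1 f = f')//; apply/funext => x.
  by rewrite derive1E; have [] := df x.
elim: Gf => {f} [f /H//|f g _ [f' df Gf] _ [g' dg Gg]|f g Gf' [f' df Gf] Gg' [g' dg Gg]].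
  exists (fun x => f' x + g' x); last exact: gen_add.
  by move=> x; have ? := df x; have ? := dg x; exact: is_deriveD.
exists (fun x => f x * g' x + g x * f' x).
  by move=> x; have ? := df x; have ? := dg x; exact: is_deriveM.
by apply: gen_add; apply: gen_mul.
Qed.

Lemma gen_smooth f : ring_gen (@smoothR R) f -> smoothR f.
Proof.
apply: smooth_ring_gen => {}f sf; exists (derive1 f); first exact: smooth_is_derive.
exact/gen_base/smooth_derive1.
Qed.

Lemma smoothM f g : smoothR f -> smoothR g -> smoothR (fun x => f x * g x).
Proof. by move=> sf sg; apply: gen_smooth; apply: gen_mul; exact: gen_base. Qed.

Lemma smooth_cst (c : R) : smoothR (fun=> c).
Proof.
apply: (@smooth_coind (fun f => exists c, f = fun=> c)); last by exists c.
move=> _ [d ->]; split; first by move=> x; exact: derivable_cst.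
by exists 0; apply/funext => x; rewrite derive1_cst.
Qed.

Lemma smoothN f : smoothR f -> smoothR (fun x => - f x).
Proof.
move=> /(smoothM _ _ (smooth_cst (-1))).
by congr smoothR; apply/funext => x; rewrite mulN1r.
Qed.

Lemma smooth_id : smoothR (fun x : R => x).
Proof.
apply: (@smooth_ring_gen (fun f => f = (fun x => x) \/ exists c, f = fun=> c)); last first.
  by apply: gen_base; left.
move=> f [->|[c ->]].
  by exists (fun=> 1); [move=> x; exact: is_derive_id|apply: gen_base; right; exists 1].
by exists (fun=> 0); [move=> x; exact: is_derive_cst|apply: gen_base; right; exists 0].
Qed.

Lemma smooth_trig (a : R) : smoothR (fun x => cos (a * x)) /\ smoothR (fun x => sin (a * x)).
Proof.
pose S f := [\/ f = (fun x => cos (a * x)), f = (fun x => sin (a * x)) | exists c, f = fun=> c].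
have H f : S f -> exists2 f', forall x, is_derive x (1 : R) f (f' x) & ring_gen S f'.
  case=> [->|->|[c ->]].
  - exists (fun x => - a * sin (a * x)).
      by move=> x; apply: is_derive_eq; rewrite /GRing.scale/=; ring.
    by apply: gen_mul; apply: gen_base; [apply: Or33; exists (- a)|exact: Or32].
  - exists (fun x => a * cos (a * x)).
      by move=> x; apply: is_derive_eq; rewrite /GRing.scale/=; ring.
    by apply: gen_mul; apply: gen_base; [apply: Or33; exists a|exact: Or31].
  - by exists (fun=> 0); [move=> x; exact: is_derive_cst|apply: gen_base; apply: Or33; exists 0].
by split; apply: (smooth_ring_gen _ H); apply: gen_base; [exact: Or31|exact: Or32].
Qed.

Lemma derive1_comp_affine f (a b : R) : (forall x, derivable f x 1) ->
  forall x, is_derive x (1 : R) (fun x => f (a * x + b)) (a * derive1 f (a * x + b)).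
Proof.
move=> df x.
have d1 : is_derive x (1 : R) (fun x : R => a * x + b) a.
  by apply: is_derive_eq; rewrite /GRing.scale/=; ring.
have d2 : is_derive (a * x + b) (1 : R) f (derive1 f (a * x + b)).
  by apply: DeriveDef; [exact: df|rewrite derive1E].
have := @is_derive1_comp _ f (fun x : R => a * x + b) x _ _ d2 d1.
by rewrite mulrC.
Qed.

Lemma smooth_affine f (a b : R) : smoothR f -> smoothR (fun x => f (a * x + b)).
Proof.
move=> sf; pose S g := (exists2 f, smoothR f & g = fun x => f (a * x + b)) \/ exists c, g = fun=> c.
apply: (@smooth_ring_gen S); last by apply: gen_base; left; exists f.
move=> _ [[g sg ->]|[c ->]].
  exists (fun x => a * derive1 g (a * x + b)).
    by move=> x; exact/derive1_comp_affine/smooth_derivable.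
  apply: gen_mul; apply: gen_base; [by right; exists a|left].
  by exists (derive1 g); first exact: smooth_derive1.
by exists (fun=> 0); [move=> x; exact: is_derive_cst|apply: gen_base; right; exists 0].
Qed.

(** The classical smooth function flat at 0 is [flat 0]. The powers [x ^- n] are included because
    differentiation produces them: the whole family together with the constants generates a ring
    closed under derivation. *)
Definition flat (n : nat) (x : R) : R := if 0 < x then x ^- n * expR (- x^-1) else 0.

Lemma flat_bound n x : 0 <= flat n x.
Proof. by rewrite /flat; case: ifP => // x0; rewrite mulr_ge0 ?expR_ge0// invr_ge0 exprn_ge0// ltW. Qed.

(** With [y = x^-1], one term of the exponential series gives [y ^+ n.+1 <= (n.+1)! * expR y], and
    [x] cancels one power of [y]. *)
Lemma flat_le n x : flat n x <= (n.+1)`!%:R * `|x|.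
Proof.
rewrite /flat; case: ifP => [x0|_]; last by rewrite mulr_ge0.
rewrite (gtr0_norm x0) expRN.
have y0 : 0 <= x^-1 by rewrite invr_ge0 ltW.
have H : x^-1 ^+ n.+1 / (n.+1)`!%:R <= expR x^-1.
  by apply: le_trans (expR_ge1Dxn n y0); rewrite lerDr.
have F0 : 0 < (n.+1)`!%:R :> R by rewrite ltr0n fact_gt0.
rewrite ler_pdivrMr// in H.
rewrite ler_pdivrMr ?expR_gt0// -exprVn.
rewrite (_ : x^-1 ^+ n = x * x^-1 ^+ n.+1).
  by apply: le_trans (ler_wpM2l (ltW x0) H) _; rewrite mulrC -mulrA mulrC.
by rewrite exprS mulrA divff ?mul1r// gt_eqF.
Qed.

Lemma flatS n x : flat n x = x * flat n.+1 x.
Proof.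
rewrite /flat; case: ifP => [x0|_]; last by rewrite mulr0.
by rewrite mulrA exprS invfM mulrA divff ?mul1r// gt_eqF.
Qed.

Lemma flat_derive n (x : R) : is_derive x (1 : R) (flat n) (flat n.+2 x - n%:R * flat n.+1 x).
Proof.
have [x0|x0|->] := ltgtP x 0.
- rewrite (_ : _ - _ = 0); last by rewrite /flat ltNge (ltW x0)/= mulr0 subr0.
  apply: (@near_eq_is_derive _ _ _ (fun=> 0)) => //.
  by near=> y; rewrite /flat ifF//; apply/negbTE; rewrite -leNgt; apply: ltW; near: y; exact: (lt_nbhsl x0).
- have xn : x != 0 by rewrite gt_eqF.
  have dV : is_derive x (1 : R) (fun y : R => y^-1) (- x ^- 2).
    apply: DeriveDef; first by apply: derivableV => //; exact: derivable_id.
    by rewrite deriveV//= derive_id /GRing.scale/= mulr1.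
  have D : is_derive x (1 : R) (fun y : R => y^-1 ^+ n * expR (- y^-1))
      (x ^- n.+2 * expR (- x^-1) - n%:R * (x ^- n.+1 * expR (- x^-1))).
    have dX := @is_deriveX _ _ (fun y : R => y^-1) n _ _ _ dV.
    have dN := is_deriveN dV.
    have dE := @is_derive1_comp _ expR (fun y : R => - y^-1) x _ _ (is_derive_expR _) dN.
    rewrite exprfctE in dX.
    apply: (is_derive_eq (is_deriveM dX dE)); rewrite /GRing.scale/= -!exprVn.
    case: n {dX} => [|n]; first by rewrite !expr0; ring.
    by rewrite /= !exprS; ring.
  rewrite {2 3}/flat x0; apply: near_eq_is_derive D.
  by near=> y; rewrite /flat ifT ?exprVn//; near: y; exact: (lt_nbhsr x0).
- rewrite (_ : _ - _ = 0); last by rewrite /flat ltxx/= mulr0 subr0.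
  (* By [flatS] the difference quotient at 0 is [flat n.+1 h], which [flat_le] bounds by a multiple
     of the absolute value of [h]. *)
  have c0 : h^-1 *: (flat n (h + 0) - flat n 0) @[h --> 0^'] --> (0 : R).
    apply: norm_cvg0.
    apply: (@squeeze_cvgr _ _ _ _ (cst 0) (fun h : R => (n.+2)`!%:R * `|h|)).
    + near=> h; rewrite normr_ge0/= addr0 {2}/flat ltxx subr0 flatS /GRing.scale/=.
      rewrite mulrA mulVf ?mul1r; last by near: h; exact: nbhs_dnbhs_neq.
      by rewrite ger0_norm ?flat_bound// flat_le.
    + exact: cvg_cst.
    + rewrite -[X in _ --> X](mulr0 (n.+2)`!%:R); apply: cvgM; first exact: cvg_cst.
      have H : `|h| @[h --> (0 : R)] --> `|0 : R| by exact: norm_continuous.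
      by rewrite normr0 in H; exact: cvg_trans (cvg_app _ (@nbhs_dnbhs R 0)) H.
  apply: DeriveDef.
    by apply/cvg_ex; exists 0; under eq_fun do rewrite scaler1.
  by apply/cvg_lim => //; under eq_fun do rewrite scaler1.
Unshelve. all: by end_near. Qed.

Lemma smooth_flat : smoothR (flat 0).
Proof.
pose S f := (exists n, f = flat n) \/ exists c : R, f = fun=> c.
apply: (@smooth_ring_gen S); last by apply: gen_base; left; exists 0%N.
move=> _ [[n ->]|[c ->]].
  exists (fun x => flat n.+2 x + (- n%:R) * flat n.+1 x).
    by move=> x; rewrite mulNr; exact: flat_derive.
  apply: gen_add; first by apply: gen_base; left; exists n.+2.
  by apply: gen_mul; apply: gen_base; [right; exists (- n%:R)|left; exists n.+1].
by exists (fun=> 0); [move=> x; exact: is_derive_cst|apply: gen_base; right; exists 0].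
Qed.

Definition bump f := smoothR f /\ exists r : R, forall x, r < `|x| -> f x = 0.

Lemma bump_exists (a : R) : 0 < a -> exists f, [/\ smoothR f,
  forall x, 0 <= f x, forall x, f (- x) = f x, f 0 > 0 & forall x, a <= `|x| -> f x = 0].
Proof.
move=> a0; exists (fun x => flat 0 (1 * x + a) * flat 0 ((-1) * x + a)); split.
- by apply: smoothM; apply: smooth_affine; exact: smooth_flat.
- by move=> x; rewrite mulr_ge0// flat_bound.
- by move=> x; rewrite mulrC; congr (flat 0 _ * flat 0 _); ring.
- by rewrite !mulr0 !add0r /flat a0 expr0 invr1 mul1r mulr_gt0// expR_gt0.
- move=> x ax; have [x0|x0] := lerP 0 x.
    by rewrite ger0_norm// in ax; rewrite [X in _ * X]/flat ifF ?mulr0//; lra.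
  by rewrite ltr0_norm// in ax; rewrite {1}/flat ifF ?mul0r//; lra.
Qed.

End Smooth.
(** * Cosine and sine transforms of bump functions *)

Section Bump.
Context {R : realType}.
Implicit Types (f g : R -> R).
Local Notation mu := (@lebesgue_measure R).

Lemma bump_continuous f : bump f -> continuous f.
Proof. by move=> [/smooth_continuous]. Qed.

Lemma bump_derive1 f : bump f -> bump (derive1 f).
Proof.
move=> [sf [r fr]]; split; first exact: smooth_derive1.
exists r => x rx; rewrite derive1E (@near_eq_derive _ _ _ f (fun=> 0)) ?derive_cst//.
near=> y; apply: fr; near: y.
by apply: (@cvgr_norm_gt _ _ _ _ _ id x); [exact: cvg_id|].
Unshelve. all: by end_near. Qed.

Lemma bump_is_derive f : bump f -> forall x, is_derive x (1 : R) f (derive1 f x).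
Proof. by move=> [/smooth_is_derive]. Qed.

Lemma bumpM f g : bump f -> smoothR g -> bump (fun x => f x * g x).
Proof.
move=> [sf [r fr]] sg; split; first exact: smoothM.
by exists r => x rx; rewrite fr// mul0r.
Qed.

Lemma bumpN f : bump f -> bump (fun x => - f x).
Proof.
move=> [sf [r fr]]; split; first exact: smoothN.
by exists r => x rx; rewrite fr ?oppr0.
Qed.

Lemma bump0 : bump (fun=> 0 : R).
Proof. by split; [exact: smooth_cst|exists 0]. Qed.

Lemma bump_idM f : bump f -> bump (fun x => x * f x).
Proof.
move=> bf; have := bumpM _ _ bf smooth_id.
by congr bump; apply/funext => x; rewrite mulrC.
Qed.

Lemma bump_shift f (t : R) : bump f -> bump (fun x => f (x + t)).
Proof.
move=> [sf [r fr]]; split.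
  have := smooth_affine _ 1 t sf; congr smoothR.
  by apply/funext => x; rewrite mul1r.
exists (r + `|t|) => x rx; apply: fr.
have := ler_normB (x + t) t; rewrite addrK => H; lra.
Qed.

Lemma bump_bounded f : bump f -> exists M, forall x, `|f x| <= M.
Proof.
move=> bf; have cf := bump_continuous _ bf; have [_ [r fr]] := bf.
have cn : continuous (fun x => `|f x|).
  by move=> x; apply: cvg_norm; exact: cf.
have [|c _ cmax] := @EVT_max _ (fun x => `|f x|) (- `|r|) `|r| _ (continuous_subspaceT cn).
  by rewrite ge0_cp.
exists `|f c| => x; have [xr|xr] := lerP `|x| `|r|.
  by apply: cmax; rewrite in_itv/= -ler_norml.
by rewrite fr ?normr0//; exact: le_lt_trans (ler_norm r) xr.
Qed.

Lemma bump_intble f : bump f -> intble f.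
Proof.
move=> bf; have [M fM] := bump_bounded _ bf; have [_ [r fr]] := bf.
apply: (@intble_decay _ _ ((1 + r ^+ 2) * M)).
  by apply: continuous_meas; exact: bump_continuous.
move=> x; have [xr|xr] := lerP `|x| r; last first.
  rewrite fr// normr0 mulr0 mulr_ge0// ?addr_ge0 ?sqr_ge0//.
  exact: le_trans (fM 0).
apply: ler_pM => //; first by rewrite addr_ge0// sqr_ge0.
by rewrite lerD2l -(@real_normK _ x) ?num_real// lerXn2r// nnegrE; exact: le_trans xr.
Qed.

Lemma Int_FTC (F f : R -> R) (a b : R) : a < b -> continuous f ->
  (forall x, is_derive x (1 : R) F (f x)) -> Int (f \_ `[a, b]%classic) = F b - F a.
Proof.
move=> ab cf dF.
have cF : continuous F by apply: derivable_continuous => x; have [] := dF x.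
rewrite /Int -Rintegral_mkcond /Rintegral (@continuous_FTC2 _ f F)//.
- exact: continuous_subspaceT.
- split.
  + by move=> x _; have [] := dF x.
  + by apply: cvg_at_right_filter; exact: cF.
  + by apply: cvg_at_left_filter; exact: cF.
- by move=> x _; rewrite derive1E; have [] := dF x.
Qed.

Lemma Int_derive0 (F f : R -> R) (r : R) : (forall x, r < `|x| -> F x = 0) ->
  (forall x, r < `|x| -> f x = 0) -> continuous f ->
  (forall x, is_derive x (1 : R) F (f x)) -> Int f = 0.
Proof.
move=> Fr fr cf dF; pose b := `|r| + 1.
have rb : r < b by rewrite /b; have := ler_norm r; lra.
have b0 : 0 < b by rewrite /b ltr_wpDl.
have fE : f = f \_ `[- b, b]%classic.
  apply/funext => x; rewrite patchE; case: ifPn => // xb; apply: fr.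
  apply: lt_trans rb _; rewrite ltNge; apply: contra xb.
  by rewrite ler_norml inE/= in_itv.
rewrite fE (Int_FTC F)//; last by lra.
by rewrite !Fr ?subr0// ?normrN gtr0_norm.
Qed.

(** For even [f] the sine part vanishes and [fcos f] is the Fourier transform itself; this is the
    kernel [K]. *)
Definition fcos f (u : R) := Int (fun s => f s * cos (u * s)).
Definition fsin f (u : R) := Int (fun s => f s * sin (u * s)).

Lemma bump_cos f (u : R) : bump f -> bump (fun s => f s * cos (u * s)).
Proof. by move=> bf; apply: bumpM => //; have [] := smooth_trig u. Qed.

Lemma bump_sin f (u : R) : bump f -> bump (fun s => f s * sin (u * s)).
Proof. by move=> bf; apply: bumpM => //; have [] := smooth_trig u. Qed.

Lemma fcos_derive f : bump f -> forall u, is_derive u (1 : R) (fcos f) (- fsin (fun s => s * f s) u).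
Proof.
move=> bf u; rewrite -Int_N; last exact/bump_intble/bump_sin/bump_idM.
apply: (@Int_derive _ (fun u s => f s * cos (u * s)) (fun u s => - (s * f s * sin (u * s))) (fun s => `|s * f s|)).
- by move=> v; exact/bump_intble/bump_cos.
- by move=> v s; apply: is_derive_eq; rewrite /GRing.scale/=; ring.
- by move=> v s; rewrite normrN normrM ler_piMr// sin_max.
- exact/intble_norm/bump_intble/bump_idM.
Qed.

Lemma fsin_derive f : bump f -> forall u, is_derive u (1 : R) (fsin f) (fcos (fun s => s * f s) u).
Proof.
move=> bf u.
apply: (@Int_derive _ (fun u s => f s * sin (u * s)) (fun u s => s * f s * cos (u * s)) (fun s => `|s * f s|)).
- by move=> v; exact/bump_intble/bump_sin.
- by move=> v s; apply: is_derive_eq; rewrite /GRing.scale/=; ring.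
- by move=> v s; rewrite normrM ler_piMr// cos_max.
- exact/intble_norm/bump_intble/bump_idM.
Qed.

Lemma bump_I_derive1 f : bump f -> Int (derive1 f) = 0.
Proof.
move=> bf; have bf' := bump_derive1 _ bf; have [_ [r fr]] := bf; have [_ [q fq]] := bf'.
apply: (@Int_derive0 f _ (Num.max r q)).
- by move=> x; rewrite gt_max => /andP[? ?]; exact: fr.
- by move=> x; rewrite gt_max => /andP[? ?]; exact: fq.
- exact: bump_continuous.
- exact: bump_is_derive.
Qed.

(** Integration by parts: the derivative of [f s * sin (u * s)] has integral 0. This exchange of [u]
    for a derivative is the source of all decay of the transforms. *)
Lemma fcosM f : bump f -> forall u, u * fcos f u = - fsin (derive1 f) u.
Proof.
move=> bf u; have bf' := bump_derive1 _ bf.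
have E : derive1 (fun s => f s * sin (u * s)) = fun s => derive1 f s * sin (u * s) + u * (f s * cos (u * s)).
  apply/funext => s; have df := bump_is_derive _ bf s.
  rewrite derive1E; apply: derive_val; apply: is_derive_eq.
  by rewrite /GRing.scale/=; ring.
have := bump_I_derive1 _ (bump_sin _ u bf); rewrite E Int_D.
- by rewrite Int_Z => [|]; [rewrite addrC => /eqP; rewrite addr_eq0 => /eqP|exact/bump_intble/bump_cos].
- exact/bump_intble/bump_sin.
- exact/intbleZ/bump_intble/bump_cos.
Qed.

Lemma fsinM f : bump f -> forall u, u * fsin f u = fcos (derive1 f) u.
Proof.
move=> bf u; have bf' := bump_derive1 _ bf.
have E : derive1 (fun s => f s * cos (u * s)) = fun s => derive1 f s * cos (u * s) - u * (f s * sin (u * s)).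
  apply/funext => s; have df := bump_is_derive _ bf s.
  rewrite derive1E; apply: derive_val; apply: is_derive_eq.
  by rewrite /GRing.scale/=; ring.
have := bump_I_derive1 _ (bump_cos _ u bf); rewrite E Int_B.
- by rewrite Int_Z => [|]; [move=> /eqP; rewrite subr_eq0 => /eqP|exact/bump_intble/bump_sin].
- exact/bump_intble/bump_cos.
- exact/intbleZ/bump_intble/bump_sin.
Qed.

(** Differentiation and multiplication by [u] both exchange cosine and sine transforms, so neither
    kind alone is a stable class. Their sums are, and boundedness of each member then yields
    integrability and every Schwartz estimate. *)
Definition trig_transform (F : R -> R) :=
  exists f g, [/\ bump f, bump g & F = fun u => fcos f u + fsin g u].

Lemma fcos_trig f : bump f -> trig_transform (fcos f).
Proof.
move=> bf; exists f, (fun=> 0); split => //; first exact: bump0.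
apply/funext => u; rewrite /fsin (Int_eq _ (fun=> 0)) => [|s]; last by rewrite mul0r.
by rewrite Int_0 addr0.
Qed.

Lemma fsinN f : bump f -> fsin (fun s => - f s) = fun u => - fsin f u.
Proof.
move=> bf; apply/funext => u; rewrite -Int_N; last exact/bump_intble/bump_sin.
by apply: Int_eq => s; rewrite mulNr.
Qed.

Lemma trig_derive F : trig_transform F ->
  (forall x, derivable F x 1) /\ trig_transform (derive1 F).
Proof.
move=> [f [g [bf bg ->]]].
have d u : is_derive u (1 : R) (fun u => fcos f u + fsin g u)
    (fcos (fun s => s * g s) u + fsin (fun s => - (s * f s)) u).
  rewrite fsinN; last exact: bump_idM.
  by rewrite addrC; have := fcos_derive _ bf u; have := fsin_derive _ bg u => ? ?; exact: is_deriveD.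
split=> [x|]; first by have [] := d x.
exists (fun s => s * g s), (fun s => - (s * f s)); split; first exact: bump_idM.
  exact/bumpN/bump_idM.
by apply/funext => u; rewrite derive1E; have [] := d u.
Qed.

Lemma trig_smooth F : trig_transform F -> smoothR F.
Proof. by apply: smooth_coind => {}F; exact: trig_derive. Qed.

Lemma trig_idM F : trig_transform F -> trig_transform (fun u => u * F u).
Proof.
move=> [f [g [bf bg ->]]].
exists (derive1 g), (fun s => - derive1 f s); split; first exact: bump_derive1.
  exact/bumpN/bump_derive1.
apply/funext => u; rewrite fsinN; last exact: bump_derive1.
by rewrite mulrDr fcosM// fsinM// addrC.
Qed.

Lemma trig_bounded F : trig_transform F -> exists M, forall u, `|F u| <= M.
Proof.
move=> [f [g [bf bg ->]]]; exists (Int (fun s => `|f s|) + Int (fun s => `|g s|)) => u.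
apply: (le_trans (ler_normD _ _)); apply: lerD; apply: Int_bound.
- exact/bump_intble/bump_cos.
- exact/intble_norm/bump_intble.
- by move=> s; rewrite normrM ler_piMr// cos_max.
- exact/bump_intble/bump_sin.
- exact/intble_norm/bump_intble.
- by move=> s; rewrite normrM ler_piMr// sin_max.
Qed.

Lemma trig_exprM F k : trig_transform F -> trig_transform (fun u => u ^+ k * F u).
Proof.
elim: k F => [|k IH] F tF.
  by move: tF; congr trig_transform; apply/funext => u; rewrite expr0 mul1r.
by move: (IH _ (trig_idM _ tF)); congr trig_transform; apply/funext => u; rewrite exprSr mulrA.
Qed.

Lemma trig_intble F : trig_transform F -> intble F.
Proof.
move=> tF; have [M FM] := trig_bounded _ tF.
have [M2 FM2] := trig_bounded _ (trig_exprM _ 2 tF).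
apply: (@intble_decay _ _ (M + M2)).
  by apply: continuous_meas; exact/smooth_continuous/trig_smooth.
move=> x; rewrite mulrDl mul1r lerD//.
by have := FM2 x; rewrite normrM ger0_norm// sqr_ge0.
Qed.

Lemma trig_schwartz F : trig_transform F -> schwartz (fun u => (F u)%:C).
Proof.
move=> tF.
have D n : cderivn n (fun u => (F u)%:C) = fun u => (iter n (@derive1 R R) F u)%:C.
  elim: n => [//|n IH]; rewrite /cderivn iterS -/(cderivn n _) IH /cderiv; apply/funext => u.
  by rewrite /comp /cRe /cIm/= derive1_cst.
have T n : trig_transform (iter n (@derive1 R R) F).
  by elim: n => [//|n IH]; rewrite iterS; have [] := trig_derive _ IH.
split; first by split; [exact: trig_smooth|exact: smooth_cst].
move=> k n; have [M HM] := trig_bounded _ (trig_exprM _ k (T n)).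
exists M => x; rewrite D -rmorphM normc_def/= expr0n/= addr0 sqrtr_sqr lecR.
exact: HM.
Qed.

End Bump.
(** * A nonnegative kernel with compactly supported Fourier transform *)

Section Kernel.
Context {R : realType}.
Implicit Types (f g : R -> R).
Local Notation mu := (@lebesgue_measure R).

Lemma intble_compact f (M r : R) : measurable_fun setT f -> (forall x, `|f x| <= M) ->
  (forall x, r < `|x| -> f x = 0) -> intble f.
Proof.
move=> mf fM fr; apply: (@intble_decay _ _ ((1 + r ^+ 2) * M)) => // x.
have [xr|xr] := lerP `|x| r; last first.
  rewrite fr// normr0 mulr0 mulr_ge0// ?addr_ge0 ?sqr_ge0//.
  exact: le_trans (fM 0).
apply: ler_pM => //; first by rewrite addr_ge0// sqr_ge0.
by rewrite lerD2l -(@real_normK _ x) ?num_real// lerXn2r// nnegrE; exact: le_trans xr.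
Qed.

Lemma continuous_pos f : continuous f -> 0 < f 0 ->
  exists2 r : R, 0 < r & forall x, `|x| <= r -> f 0 / 2 <= f x.
Proof.
move=> cf f0; have h : f 0 / 2 < f 0 by lra.
have [r /= r0 H] := (@nbhs_ballP _ _ _ _).1 (@cvgr_ge _ _ _ _ f (f 0) (cf 0) (f 0 / 2) h).
exists (r / 2) => [|x xr]; first by lra.
by apply: H; rewrite /ball /= sub0r normrN; lra.
Qed.

(** * Convolution of bump functions *)

Definition conv f g (t : R) := Int (fun s => f s * g (t - s)).

Lemma bump_conv_integrand f g (t : R) : bump f -> bump g -> bump (fun s => f s * g (t - s)).
Proof.
move=> bf [sg _]; apply: bumpM => //.
have := smooth_affine _ (-1) t sg; congr smoothR.
by apply/funext => x; congr g; ring.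
Qed.

Lemma conv_derive f g : bump f -> bump g ->
  forall t, is_derive t (1 : R) (conv f g) (conv f (derive1 g) t).
Proof.
move=> bf bg; have bg' := bump_derive1 _ bg; have [M gM] := bump_bounded _ bg'.
apply: (@Int_derive _ (fun t s => f s * g (t - s)) (fun t s => f s * derive1 g (t - s)) (fun s => `|f s| * M)).
- by move=> t; exact/bump_intble/bump_conv_integrand.
- move=> t s.
  have := derive1_comp_affine g 1 (- s) (smooth_derivable _ (proj1 bg)) t.
  rewrite !mul1r (_ : (fun x => g (1 * x + - s)) = fun x => g (x - s)); last first.
    by apply/funext => x; rewrite mul1r.
  by move=> d; apply: is_derive_eq; rewrite /GRing.scale/=; ring.
- by move=> t s; rewrite normrM ler_wpM2l.
- have := intbleZ M _ (intble_norm _ (bump_intble _ bf)).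
  by congr intble; apply/funext => s; rewrite mulrC.
Qed.

Lemma conv_support f g (a b : R) : (forall x, a <= `|x| -> f x = 0) ->
  (forall x, b <= `|x| -> g x = 0) -> forall t, a + b <= `|t| -> conv f g t = 0.
Proof.
move=> fa gb t abt; rewrite /conv (Int_eq _ (fun=> 0)).
  exact: Int_0.
move=> s; have [/fa->|sa] := lerP a `|s|; first by rewrite mul0r.
rewrite gb ?mulr0//.
by have := ler_normD (t - s) s; rewrite subrK; lra.
Qed.

(** Derivatives fall on the second factor only, so for fixed [f] the convolutions with bumps form a
    class stable under differentiation. *)
Lemma bump_conv f g : bump f -> bump g -> bump (conv f g).
Proof.
move=> bf bg; split.
  apply: (@smooth_coind _ (fun h => exists2 g, bump g & h = conv f g)); last by exists g.
  move=> _ [h bh ->]; have d := conv_derive _ _ bf bh.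
  split=> [x|]; first by have [] := d x.
  exists (derive1 h); first exact: bump_derive1.
  by apply/funext => x; rewrite derive1E; have [] := d x.
have [_ [r fr]] := bf; have [_ [q gq]] := bg.
exists ((r + 1) + (q + 1)) => t /ltW; apply: conv_support => x xr.
  by apply: fr; lra.
by apply: gq; lra.
Qed.

Lemma conv_even f : bump f -> (forall x, f (- x) = f x) -> forall t, conv f f (- t) = conv f f t.
Proof.
move=> bf ef t.
have [_] := Int_reflect _ (bump_intble _ (bump_conv_integrand _ _ (- t) bf bf)).
rewrite -/(conv f f (- t)) => <-; apply: Int_eq => s; rewrite ef; congr (_ * _).
by rewrite -ef; congr f; ring.
Qed.

Lemma fsin_odd f (v : R) : bump f -> fsin f (- v) = - fsin f v.
Proof.
move=> bf; rewrite -Int_N; last exact/bump_intble/bump_sin.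
by apply: Int_eq => s; rewrite mulNr sinN mulrN.
Qed.

Lemma fsin_even f (v : R) : bump f -> (forall x, f (- x) = f x) -> fsin f v = 0.
Proof.
move=> bf ef; apply: Int_odd; first exact/bump_intble/bump_sin.
by move=> s; rewrite ef mulrN sinN mulrN.
Qed.

(** The addition formula also yields a multiple of [fsin f v], which is 0 because [f] is even. *)
Lemma fcos_shift f (t v : R) : bump f -> (forall x, f (- x) = f x) ->
  fcos (fun s => f (s + t)) v = cos (v * t) * fcos f v.
Proof.
move=> bf ef.
have b1 := bump_intble _ (bump_cos _ v bf); have b2 := bump_intble _ (bump_sin _ v bf).
have E s : cos (v * t) * (f s * cos (v * s)) + sin (v * t) * (f s * sin (v * s)) = f s * cos (v * (s - t)).
  by rewrite mulrBr cosB; ring.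
have j : intble (fun s => f s * cos (v * (s - t))).
  have := intbleD _ _ (intbleZ (cos (v * t)) _ b1) (intbleZ (sin (v * t)) _ b2).
  by congr intble; apply/funext.
have [_ H] := Int_shift t _ j.
rewrite /fcos (_ : Int _ = Int (fun s => f s * cos (v * (s - t)))); last first.
  by rewrite -H; apply: Int_eq => s; rewrite addrK.
rewrite (Int_eq _ _ (fun s => esym (E s))) Int_D; [|exact: intbleZ..].
by rewrite !Int_Z// -/(fsin f v) fsin_even// mulr0 addr0.
Qed.

Lemma fsin_shift f (t v : R) : bump f -> (forall x, f (- x) = f x) ->
  fsin (fun s => f (s + t)) v = - (sin (v * t) * fcos f v).
Proof.
move=> bf ef.
have b1 := bump_intble _ (bump_cos _ v bf); have b2 := bump_intble _ (bump_sin _ v bf).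
have E s : cos (v * t) * (f s * sin (v * s)) - sin (v * t) * (f s * cos (v * s)) = f s * sin (v * (s - t)).
  by rewrite mulrBr sinB; ring.
have j : intble (fun s => f s * sin (v * (s - t))).
  have := intbleB _ _ (intbleZ (cos (v * t)) _ b2) (intbleZ (sin (v * t)) _ b1).
  by congr intble; apply/funext.
have [_ H] := Int_shift t _ j.
rewrite {1}/fsin (_ : Int _ = Int (fun s => f s * sin (v * (s - t)))); last first.
  by rewrite -H; apply: Int_eq => s; rewrite addrK.
rewrite (Int_eq _ _ (fun s => esym (E s))) Int_B; [|exact: intbleZ..].
by rewrite !Int_Z// -/(fsin f v) fsin_even// mulr0 sub0r.
Qed.

Lemma fcos_conv f (v : R) : bump f -> (forall x, f (- x) = f x) ->
  fcos (conv f f) v = fcos f v ^+ 2.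
Proof.
move=> bf ef; have [M fM] := bump_bounded _ bf; have [_ [r fr]] := bf.
have cf := bump_continuous _ bf.
have jc t := bump_intble _ (bump_conv_integrand _ _ t bf bf).
pose h (t s : R) := f s * f (t - s) * cos (v * t).
(* If [t] lies beyond twice the support radius, [f s] or [f (t - s)] vanishes; hence [a t] times the
   absolute value of [f s] is a product majorant. *)
pose a (t : R) := M * (\1_(`[- (`|r| *+ 2), `|r| *+ 2]%classic : set R) t).
have ja : intble a.
  apply: intbleZ; apply: (@intble_compact _ 1 (`|r| *+ 2)); first exact: measurable_indic.
    by move=> x; rewrite indicE; case: (_ \in _); rewrite ?normr1 ?normr0.
  move=> x; rewrite indicE ltNge ler_norml => H.
  by rewrite memNset//= in_itv/=; exact/negP.
transitivity (Int (fun t => Int (h t))).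
  apply: Int_eq => t; rewrite /conv mulrC -Int_Z//; apply: Int_eq => s; rewrite /h; ring.
rewrite (Int_fubini h a (fun s => `|f s|))//; last 3 first.
- have mf : measurable_fun setT f by exact: continuous_meas.
  rewrite /h; apply: measurable_funM; first apply: measurable_funM.
  + by apply: (measurableT_comp mf); exact: measurable_snd.
  + by apply: (measurableT_comp mf); apply: measurable_funB; [exact: measurable_fst|exact: measurable_snd].
  + apply: (measurableT_comp (continuous_meas _ (continuous_cosM v))); exact: measurable_fst.
- exact/intble_norm/bump_intble.
- move=> t s; rewrite /h /a indicE; case: (boolP (t \in _)) => [_|tr].
    rewrite /= mulr1 !normrM -mulrA mulrC ler_wpM2r//.
    by rewrite (le_trans _ (fM (t - s)))// ler_piMr// cos_max.
  rewrite mulr0 mul0r; have [sr|sr] := lerP `|s| `|r|; last first.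
    by rewrite fr ?mul0r ?normr0//; exact: le_lt_trans (ler_norm r) sr.
  rewrite (fr (t - s)) ?mulr0 ?mul0r ?normr0//.
  have {}tr : `|r| *+ 2 < `|t|.
    by rewrite ltNge ler_norml; apply: contra tr => H; rewrite inE/= in_itv.
  have := ler_normD (t - s) s; rewrite subrK; have := ler_norm r; rewrite mulr2n in tr; lra.
transitivity (Int (fun s => fcos f v * (f s * cos (v * s)))); last first.
  by rewrite Int_Z ?expr2//; exact/bump_intble/bump_cos.
apply: Int_eq => s.
have := fcos_shift _ (- s) v bf ef; rewrite mulrN cosN => H.
transitivity (f s * fcos (fun t => f (t - s)) v); last by rewrite H; ring.
rewrite /fcos -Int_Z; last by exact/bump_intble/bump_cos/bump_shift.
by apply: Int_eq => t; rewrite /h; ring.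
Qed.

Lemma kernel_exists (r : R) : 0 < r -> exists f, [/\ bump f,
  forall x, f (- x) = f x, forall x, r <= `|x| -> f x = 0,
  forall v, 0 <= fcos f v & 0 < fcos f 0].
Proof.
(* Convolving a bump with itself doubles its support, so the bump starts with half the radius. *)
move=> r0; have r2 : 0 < r / 2 by lra.
have [g [sg g0 eg gpos gr]] := bump_exists _ r2.
have bg : bump g by split=> //; exists (r / 2) => x /ltW; exact: gr.
exists (conv g g); split.
- exact: bump_conv.
- exact: conv_even.
- by move=> x rx; apply: (conv_support _ _ _ _ gr gr); lra.
- by move=> v; rewrite fcos_conv// sqr_ge0.
rewrite fcos_conv// exprn_gt0//.
have [d d0 gd] := continuous_pos _ (smooth_continuous _ sg) gpos.
have -> : fcos g 0 = Int g by apply: Int_eq => s; rewrite mul0r cos0 mulr1.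
apply: lt_le_trans (Int_lower_bound _ _ _ (bump_intble _ bg) (ltW d0) g0 gd).
by rewrite mulr_gt0 ?mulrn_wgt0//; lra.
Qed.

(** * Fourier inversion by Abel summation *)

Lemma cvg_expN_1 (e : nat -> R) (c : R) : e @ \oo --> (0 : R) ->
  (fun n => expR (- (e n * c))) @ \oo --> (1 : R).
Proof.
move=> ce; have c1 : (fun n => - (e n * c)) @ \oo --> (0 : R).
  by rewrite -oppr0; apply: cvgN; rewrite -(mul0r c); apply: cvgM => //; exact: cvg_cst.
have cE := @continuous_expR R 0; rewrite /continuous_at expR0 in cE.
exact: cvg_comp c1 cE.
Qed.

Lemma continuous_atanM (c : R) : continuous (fun s : R => atan (c * s)).
Proof.
move=> x; apply: (@continuous_comp _ _ _ (fun x => c * x) atan).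
  by apply: continuousM => //; exact: cvg_cst.
exact: continuous_atan.
Qed.

Lemma measurable_atanM (c : R) : measurable_fun setT (fun s : R => atan (c * s)).
Proof. exact: continuous_meas (continuous_atanM c). Qed.

Lemma atan_bound (y : R) : `|atan y| <= pi / 2.
Proof.
rewrite ler_norml; have := atan_gtNpi2 y; have := atan_ltpi2 y => H1 H2.
by apply/andP; split; lra.
Qed.

Lemma poisson_bound (e s : R) : 0 < e -> `|e / (e ^+ 2 + s ^+ 2)| <= e^-1.
Proof.
move=> e0; have es : 0 < e ^+ 2 + s ^+ 2 by rewrite ltr_pwDl ?exprn_gt0// sqr_ge0.
rewrite ger0_norm; last by rewrite divr_ge0// ltW.
rewrite ler_pdivrMr// mulrDr expr2 mulrA mulVf ?gt_eqF// mul1r lerDl.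
by rewrite mulr_ge0 ?sqr_ge0// invr_ge0 ltW.
Qed.

(* Abel summation of the inverse Fourier integral: the means are Poisson integrals
   of [f], which one integration by parts turns into integrals of [f'] against
   [atan (s / e)], and these converge to a jump at [0]. *)
Lemma Int_fcos_abel f (e : R) : bump f -> 0 < e ->
  Int (fun u => fcos f u * expR (- (e * `|u|))) =
    - 2 * Int (fun s => derive1 f s * atan (e^-1 * s)).
Proof.
move=> bf e0; have bf' := bump_derive1 _ bf; have jf' := bump_intble _ bf'.
have [je _] := Int_expN _ e0.
have mf := continuous_meas _ (bump_continuous _ bf).
transitivity (Int (fun u => Int (fun s => f s * cos (u * s) * expR (- (e * `|u|))))).
  apply: Int_eq => u; rewrite mulrC -Int_Z; last exact/bump_intble/bump_cos.
  by apply: Int_eq => s; rewrite mulrC.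
rewrite (Int_fubini _ (fun u => expR (- (e * `|u|))) (fun s => `|f s|))//; last 3 first.
- apply: measurable_funM; first apply: measurable_funM.
  + by apply: (measurableT_comp mf); exact: measurable_snd.
  + apply: (measurableT_comp (continuous_meas _ (@continuous_cos R))).
    by apply: measurable_funM; [exact: measurable_fst|exact: measurable_snd].
  + by apply: (measurableT_comp (continuous_meas _ (continuous_expN e))); exact: measurable_fst.
- exact/intble_norm/bump_intble.
- move=> u s; rewrite !normrM mulrC (ger0_norm (expR_ge0 _)) ler_wpM2l ?expR_ge0//.
  by rewrite ler_piMr// cos_max.
pose F s := f s * atan (e^-1 * s).
pose F' s := derive1 f s * atan (e^-1 * s) + f s * (e / (e ^+ 2 + s ^+ 2)).
have es s : e ^+ 2 + s ^+ 2 != 0 by rewrite gt_eqF// ltr_pwDl ?exprn_gt0// sqr_ge0.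
have en : e != 0 by rewrite gt_eqF.
have dF s : is_derive s (1 : R) F (F' s).
  have df := bump_is_derive _ bf s.
  have da : is_derive s (1 : R) (fun s => atan (e^-1 * s)) (e / (e ^+ 2 + s ^+ 2)).
    apply: is_derive_eq; rewrite /GRing.scale/=; field.
    by rewrite en es.
  by apply: is_derive_eq; rewrite /GRing.scale/= /F'; ring.
have j1 : intble (fun s => derive1 f s * atan (e^-1 * s)).
  apply: (@intbleM _ (pi / 2)) => //; first exact: measurable_atanM.
  by move=> s; exact: atan_bound.
have cP : continuous (fun s : R => e / (e ^+ 2 + s ^+ 2)).
  move=> s; apply: cvgM; first exact: cvg_cst.
  apply: cvgV => //; apply: cvgD; first exact: cvg_cst.
  by apply: (@exprn_continuous _ 2).
have j2 : intble (fun s => f s * (e / (e ^+ 2 + s ^+ 2))).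
  apply: (@intbleM _ (e^-1)); [exact: bump_intble|exact: continuous_meas|].
  by move=> s; exact: poisson_bound.
have : Int F' = 0.
  have [_ [r fr]] := bf; have [_ [q fq]] := bf'.
  apply: (@Int_derive0 _ F _ (Num.max r q)) => //.
  - by move=> x; rewrite gt_max => /andP[? ?]; rewrite /F fr ?mul0r.
  - by move=> x; rewrite gt_max => /andP[? ?]; rewrite /F' fr ?fq ?mul0r ?addr0.
  - move=> s; apply: cvgD; apply: cvgM; [exact: bump_continuous| |exact: bump_continuous|exact: cP].
    exact: continuous_atanM.
rewrite Int_D// addrC => /eqP; rewrite addr_eq0 => /eqP H.
rewrite mulNr -mulrN -H -Int_Z//; apply: Int_eq => s.
transitivity (f s * Int (fun u => expR (- (e * `|u|)) * cos (s * u))).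
  rewrite -Int_Z; first by apply: Int_eq => u; rewrite (mulrC u); ring.
  apply: (@intbleM _ 1) => //; first exact: continuous_meas (continuous_cosM _).
  by move=> u; rewrite cos_max.
by rewrite Int_expN_cos//; ring.
Qed.

(** Dominated convergence applies to both sides of [Int_fcos_abel]. On the right [atan] tends to
    [pi / 2] times the sign, and integrating [derive1 f] over each half-line contributes [f 0] up to
    sign, whence [- pi * (- f 0 - f 0)]. *)
Lemma fcos_inversion f : bump f -> Int (fcos f) = 2 * pi * f 0.
Proof.
move=> bf; have bf' := bump_derive1 _ bf; have jf' := bump_intble _ bf'.
have tf := fcos_trig _ bf; have jC := trig_intble _ tf.
have mC := intble_meas _ jC.
pose e (n : nat) : R := n.+1%:R^-1.
have e0 n : 0 < e n by rewrite invr_gt0.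
have ce : e @ \oo --> (0 : R) by exact: cvg_harmonic.
have [_ L1] : intble (fcos f) /\ (fun n => Int (fun u => fcos f u * expR (- (e n * `|u|)))) @ \oo --> Int (fcos f).
  apply: (@Int_dct _ _ _ (fun u => `|fcos f u|)).
  - move=> n; apply: measurable_funM => //; exact: continuous_meas (continuous_expN _).
  - move=> u; rewrite -[X in _ --> X]mulr1; apply: cvgM; first exact: cvg_cst.
    exact: cvg_expN_1.
  - exact: intble_norm.
  - move=> n u; rewrite normrM ler_piMr// ger0_norm ?expR_ge0// expR_le1 oppr_le0.
    by rewrite mulr_ge0// ltW.
have [js L2] : intble (fun s => derive1 f s * (pi / 2 * Num.sg s)) /\
    (fun n => Int (fun s => derive1 f s * atan ((e n)^-1 * s))) @ \oo --> Int (fun s => derive1 f s * (pi / 2 * Num.sg s)).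
  apply: (@Int_dct _ _ _ (fun s => pi / 2 * `|derive1 f s|)).
  - by move=> n; apply: measurable_funM; [exact: intble_meas|exact: measurable_atanM].
  - move=> s; apply: cvgM; first exact: cvg_cst.
    have pos (x : R) : 0 < x -> atan ((e n)^-1 * x) @[n --> \oo] --> (pi / 2 : R).
      move=> x0; apply: (@cvg_comp _ _ _ (fun n => (e n)^-1 * x) (@atan R) _ (+oo%R)); last exact: cvgy_atan.
      apply/cvgryPge => A; near=> n; rewrite /e invrK -ler_pdivrMr//.
      apply: (@le_trans _ _ n%:R); last by rewrite ler_nat.
      by near: n; exact: nbhs_infty_ger.
    have [s0|s0|->] := ltgtP s 0.
    + rewrite (ltr0_sg s0) mulrN1.
      have -> : (fun n => atan ((e n)^-1 * s)) = (fun n => - atan ((e n)^-1 * (- s))).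
        by apply/funext => n; rewrite mulrN atanN opprK.
      by apply: cvgN; apply: pos; rewrite oppr_gt0.
    + by rewrite (gtr0_sg s0) mulr1; exact: pos.
    + by rewrite sgr0 mulr0; under eq_fun do rewrite mulr0 atan0; exact: cvg_cst.
  - exact/intbleZ/intble_norm.
  - by move=> n s; rewrite normrM mulrC ler_wpM2r// atan_bound.
have -> : Int (fcos f) = - 2 * Int (fun s => derive1 f s * (pi / 2 * Num.sg s)).
  apply: cvg_unique L1 _; first exact: norm_hausdorff.
  rewrite (_ : (fun n => _) = (fun n => - 2 * Int (fun s => derive1 f s * atan ((e n)^-1 * s)))).
    by apply: cvgM => //; exact: cvg_cst.
  by apply/funext => n; rewrite Int_fcos_abel.
have [_ [r fr]] := bf; have [_ [q fq]] := bf'.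
pose b := Num.max `|r| `|q| + 1.
have [rb qb b0] : [/\ r < b, q < b & 0 < b].
  have : `|r| <= Num.max `|r| `|q| by rewrite le_max lexx.
  have : `|q| <= Num.max `|r| `|q| by rewrite le_max lexx orbT.
  have := ler_norm r; have := ler_norm q; have := normr_ge0 r; rewrite /b.
  by move=> *; split; lra.
have cf' := bump_continuous _ bf'.
have J1 := Int_FTC f _ 0 b b0 cf' (bump_is_derive _ bf).
have J2 := Int_FTC f _ (- b) 0 _ cf' (bump_is_derive _ bf).
(* At [s = 0] both closed intervals contain [s] and the two restrictions cancel, in agreement with
   [sg 0 = 0]. *)
have E s : derive1 f s * (pi / 2 * Num.sg s) =
    pi / 2 * ((derive1 f \_ `[0, b]%classic) s - (derive1 f \_ `[- b, 0]%classic) s).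
  have PE A : (derive1 f \_ A) s = if s \in A then derive1 f s else 0 by rewrite patchE.
  rewrite !PE; have [bs|sb] := ltrP b `|s|.
    rewrite fq ?(lt_trans qb bs)// mul0r.
    by case: ifP; case: ifP; rewrite subr0 mulr0.
  move: sb; rewrite ler_norml => /andP[s1 s2].
  have [s0|s0|->] := ltgtP s 0.
  - rewrite memNset/= ?in_itv/=; last by apply/negP; rewrite leNgt s0.
    rewrite mem_set/= ?in_itv/= ?s1 ?ltW// ltr0_sg//; ring.
  - rewrite mem_set/= ?in_itv/= ?s2 ?ltW// memNset/= ?in_itv/=; last first.
      by apply/negP; rewrite (leNgt s) s0 andbF.
    by rewrite gtr0_sg//; ring.
  - rewrite sgr0 mem_set/= ?in_itv/= ?lexx ?ltW// mem_set/= ?in_itv/= ?lexx ?andbT ?oppr_le0 ?ltW//.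
    by ring.
have jp (A : set R) : measurable A -> intble (derive1 f \_ A).
  move=> mA; apply: (@intble_le _ _ (fun s => `|derive1 f s|)).
  - by apply/measurable_restrict => //; apply: measurable_funTS; exact: intble_meas.
  - exact: intble_norm.
  - by move=> s; rewrite patchE; case: ifP; rewrite ?normr0.
rewrite (Int_eq _ _ E) Int_Z; last by apply: intbleB; exact: jp.
rewrite Int_B ?J1 ?J2; [|by lra|exact: jp..].
have fb : f b = 0 by apply: fr; rewrite gtr0_norm.
have fNb : f (- b) = 0 by apply: fr; rewrite normrN gtr0_norm.
by rewrite fb fNb; field.
Unshelve. all: by end_near. Qed.

(** Multiplying [fcos f] by a cosine or sine of [t * v] gives, up to sign, a transform of the
    translate of [f] by [t]. Inversion at the single point 0 then yields [f t], and the sine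
    transforms integrate to 0 by oddness. *)
Lemma kernel_fourier f (t x : R) : bump f -> (forall x, f (- x) = f x) ->
  Int (fun u => fcos f (u + x) * cos (t * u)) = 2 * pi * f t * cos (t * x) /\
  Int (fun u => fcos f (u + x) * sin (t * u)) = - (2 * pi * f t * sin (t * x)).
Proof.
move=> bf ef; have bt := bump_shift _ t bf.
have jC := trig_intble _ (fcos_trig _ bt).
have jS : intble (fsin (fun s => f (s + t))).
  apply: trig_intble; exists (fun=> 0), (fun s => f (s + t)); split=> //; first exact: bump0.
  apply/funext => u; rewrite /fcos (Int_eq _ (fun=> 0)) => [|s]; last by rewrite mul0r.
  by rewrite Int_0 add0r.
have IC := fcos_inversion _ bt; rewrite add0r in IC.
have IS : Int (fsin (fun s => f (s + t))) = 0.
  by apply: Int_odd => // v; exact: fsin_odd.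
have main (g : R -> R) (a b : R) :
    (forall v, fcos f v * g (v - x) = a * fcos (fun s => f (s + t)) v + b * fsin (fun s => f (s + t)) v) ->
    Int (fun u => fcos f (u + x) * g u) = a * (2 * pi * f t).
  move=> E.
  have j : intble (fun v => fcos f v * g (v - x)).
    have := intbleD _ _ (intbleZ a _ jC) (intbleZ b _ jS).
    by congr intble; apply/funext => v; rewrite E.
  have [_ H] := Int_shift x _ j.
  transitivity (Int (fun v => fcos f v * g (v - x))).
    by rewrite -H; apply: Int_eq => u; rewrite addrK.
  rewrite (Int_eq _ _ E) Int_D; [|exact: intbleZ..].
  by rewrite !Int_Z// IC IS mulr0 addr0.
split.
  rewrite (main (fun u => cos (t * u)) (cos (t * x)) (- sin (t * x))); first by ring.
  move=> v; rewrite fcos_shift// fsin_shift// mulrBr cosB (mulrC v t); ring.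
rewrite (main (fun u => sin (t * u)) (- sin (t * x)) (- cos (t * x))); first by ring.
by move=> v; rewrite fcos_shift// fsin_shift// mulrBr sinB (mulrC v t); ring.
Qed.

Lemma fcos_translate_trig f (x : R) : bump f -> trig_transform (fun u => fcos f (u + x)).
Proof.
move=> bf; exists (fun s => f s * cos (x * s)), (fun s => - (f s * sin (x * s))).
split; [exact: bump_cos|exact/bumpN/bump_sin|].
apply/funext => u; rewrite fsinN; last exact: bump_sin.
rewrite /fcos /fsin -Int_B; [|exact/bump_intble/bump_cos/bump_cos|exact/bump_intble/bump_sin/bump_sin].
by apply: Int_eq => s; rewrite mulrDl cosD; ring.
Qed.

End Kernel.
(** * Kernel means of slowly decreasing functions *)

Section Tauberian.
Context {R : realType}.
Implicit Types (f g K : R -> R).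
Local Notation mu := (@lebesgue_measure R).

Definition far (A v : R) : R := ((A <= `|v|)%R)%:R.

Lemma far_ge0 A v : 0 <= far A v. Proof. by []. Qed.

Lemma far_le1 A v : far A v <= 1. Proof. by rewrite /far lern1 leq_b1. Qed.

Lemma far_meas A : measurable_fun setT (far A).
Proof.
rewrite (_ : far A = \1_([set v : R | A <= `|v|]%classic)); last first.
  apply/funext => v; rewrite indicE /far; case: (boolP (A <= _)) => h.
    by rewrite mem_set.
  by rewrite memNset//; exact/negP.
apply: measurable_indic.
rewrite (_ : mkset _ = `]-oo, - A]%classic `|` `[A, +oo[%classic); last first.
  apply/seteqP; split=> v /=; rewrite !in_itv/= andbT lerNr.
    by rewrite ler_normr => /orP[]; [right|left].
  by move=> H; rewrite ler_normr; apply/orP; case: H; [right|left].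
exact: measurableU.
Qed.

Lemma tail_small K (e : R) : intble K -> (forall v, 0 <= K v) -> 0 < e ->
  exists2 A : R, 0 <= A & Int (fun v => K v * far A v) <= e.
Proof.
move=> jK K0 e0.
have [_ L] : intble (fun=> 0 : R) /\ (fun n : nat => Int (fun v => K v * far n%:R v)) @ \oo --> Int (fun=> 0 : R).
  apply: (@Int_dct _ _ _ K) => //.
  - by move=> n; apply: measurable_funM; [exact: intble_meas|exact: far_meas].
  - move=> v; apply: (@cvg_near_cst _ _ _ _ _ _); near=> n.
    rewrite /far lt_geF ?mulr0//; apply: (@lt_le_trans _ _ (`|v| + 1)); first by lra.
    by near: n; exact: nbhs_infty_ger.
  - by move=> n v; rewrite ger0_norm ?mulr_ge0 ?far_ge0// ler_piMr ?far_le1.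
rewrite Int_0 in L.
have [n _ H] := (@cvgr_le _ _ _ _ _ 0 L e e0).
by exists n%:R => //; apply: H => /=.
Unshelve. all: by end_near. Qed.

(* To the left of [x] only [h >= - l] is known; centring the kernel at [x + A], far
   to the right of [x], makes that part count with the small weight of the tail. *)
Lemma slowly_decreasing_upper K h (A B M D x l : R) :
  intble K -> intble (fun v => `|v| * K v) -> (forall v, 0 <= K v) ->
  (forall y, intble (fun u => h u * K (u - y)) /\ `|Int (fun u => h u * K (u - y))| <= B) ->
  0 <= A -> 0 <= M -> 0 <= D -> 0 <= l ->
  Int (fun v => K v * far A v) <= Int K / 8 -> 0 < Int K ->
  (forall u, x <= u -> h x - M - D * (u - x) <= h u) ->
  (forall u, u <= x -> - l <= h u) ->
  h x <= 2 * (B + (M + D * A) * Int K + D * Int (fun v => `|v| * K v)) / Int K + l / 4.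
Proof.
move=> jK jvK K0 HB A0 M0 D0 l0 tail k0 hx hl.
have B0 : 0 <= B by have [_] := HB 0; apply: le_trans.
have J0 : 0 <= Int (fun v => `|v| * K v) by apply: Int_ge0 => v; rewrite mulr_ge0.
have [hx0|hx0] := lerP (h x) 0.
  apply: le_trans hx0 _; have k1 := ltW k0.
  by repeat first [assumption|apply: addr_ge0|apply: divr_ge0|apply: mulr_ge0|exact: ler0n].
have jt : intble (fun v => K v * far A v).
  apply: (@intbleM _ 1) => //; first exact: far_meas.
  by move=> v; rewrite ger0_norm ?far_ge0 ?far_le1.
have [jy Iy] := HB (x + A).
have [jy' Iy'] := Int_shift (x + A) _ jy.
have jl : intble (fun v => h x * K v - (M + D * A) * K v - D * (`|v| * K v) - (h x + l) * (K v * far A v)).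
  by repeat apply: intbleB; exact: intbleZ.
have : Int (fun v => h x * K v - (M + D * A) * K v - D * (`|v| * K v) - (h x + l) * (K v * far A v)) <= B.
  apply: le_trans (le_trans (ler_norm _) Iy); rewrite -Iy'; apply: Int_le => // v.
  rewrite addrK (_ : _ - _ = (h x - (M + D * A) - D * `|v| - (h x + l) * far A v) * K v); last by ring.
  apply: ler_wpM2r => //.
  have v1 := ler_norm v; have v2 := ler_norm (- v); rewrite normrN in v2.
  have nn : 0 <= D * `|v| by exact: mulr_ge0.
  have nA : 0 <= D * A by exact: mulr_ge0.
  have i0 : 0 <= far A v by rewrite /far.
  have ii : 0 <= (h x + l) * far A v by rewrite mulr_ge0 ?far_ge0// addr_ge0// ltW.
  have [xv|vx] := lerP x (v + (x + A)).
    apply: le_trans (hx _ xv).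
    have : D * (v + (x + A) - x) <= D * `|v| + D * A by rewrite -mulrDr ler_wpM2l//; lra.
    lra.
  have Av : A <= `|v| by lra.
  by have := hl _ (ltW vx); rewrite /far Av mulr1; lra.
rewrite !Int_B; try (by repeat apply: intbleB; exact: intbleZ); try exact: intbleZ.
rewrite !Int_Z// => H.
have tl : (h x + l) * Int (fun v => K v * far A v) <= (h x + l) * (Int K / 8).
  by rewrite ler_wpM2l// addr_ge0// ltW.
rewrite -(ler_pM2r k0) mulrDl divfK ?gt_eqF//.
have : 0 <= l * Int K by rewrite mulr_ge0// ltW.
have : 0 <= h x * Int K by rewrite mulr_ge0// ltW.
lra.
Qed.

(** Mirror image of the upper estimate, centred at [x - A]. To the right of [x] an upper bound on
    [h] is needed, and the upper estimate supplies it: up to a point [u >= x] the function stays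
    above [- (l + M + D * (u - x))], a quarter of which enters here. *)
Lemma slowly_decreasing_lower K h (A B M D x l C1 : R) :
  intble K -> intble (fun v => `|v| * K v) -> (forall v, 0 <= K v) ->
  (forall y, intble (fun u => h u * K (u - y)) /\ `|Int (fun u => h u * K (u - y))| <= B) ->
  0 <= A -> 0 <= M -> 0 <= D -> 0 <= l -> 0 <= C1 ->
  Int (fun v => K v * far A v) <= Int K / 8 -> 0 < Int K ->
  (forall u, u <= x -> h u - M - D * (x - u) <= h x) ->
  (forall u, x <= u -> h u <= C1 + (l + M + D * (u - x)) / 4) ->
  - h x <= 2 * (B + (C1 + 2 * M + D * A) * Int K + D * Int (fun v => `|v| * K v)) / Int K + l / 2.
Proof.
move=> jK jvK K0 HB A0 M0 D0 l0 C10 tail k0 hx hl.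
have B0 : 0 <= B by have [_] := HB 0; apply: le_trans.
have J0 : 0 <= Int (fun v => `|v| * K v) by apply: Int_ge0 => v; rewrite mulr_ge0.
have [hx0|hx0] := lerP 0 (h x).
  apply: (@le_trans _ _ 0); first by rewrite oppr_le0.
  have k1 := ltW k0.
  by repeat first [assumption|apply: addr_ge0|apply: divr_ge0|apply: mulr_ge0|exact: ler0n].
have jt : intble (fun v => K v * far A v).
  apply: (@intbleM _ 1) => //; first exact: far_meas.
  by move=> v; rewrite ger0_norm ?far_ge0 ?far_le1.
have [jy Iy] := HB (x - A).
have [jy' Iy'] := Int_shift (x - A) _ jy.
have jl : intble (fun v => h x * K v + (C1 + 2 * M + D * A) * K v + D * (`|v| * K v) + (l - h x) * (K v * far A v)).
  by repeat apply: intbleD; exact: intbleZ.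
have : - B <= Int (fun v => h x * K v + (C1 + 2 * M + D * A) * K v + D * (`|v| * K v) + (l - h x) * (K v * far A v)).
  apply: (@le_trans _ _ (Int (fun u => h u * K (u - (x - A))))).
    by move: Iy; rewrite ler_norml => /andP[].
  rewrite -Iy'; apply: Int_le => // v.
  rewrite addrK (_ : _ + _ = (h x + (C1 + 2 * M + D * A) + D * `|v| + (l - h x) * far A v) * K v); last by ring.
  apply: ler_wpM2r => //.
  have v1 := ler_norm v; have v2 := ler_norm (- v); rewrite normrN in v2.
  have nn : 0 <= D * `|v| by exact: mulr_ge0.
  have nA : 0 <= D * A by exact: mulr_ge0.
  have ii : 0 <= (l - h x) * far A v by rewrite mulr_ge0 ?far_ge0//; lra.
  have [xv|vx] := lerP (v + (x - A)) x.
    have := hx _ xv.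
    have : D * (x - (v + (x - A))) <= D * `|v| + D * A by rewrite -mulrDr ler_wpM2l//; lra.
    lra.
  have Av : A <= `|v| by lra.
  have := hl _ (ltW vx).
  have : D * (v + (x - A) - x) <= D * `|v| + D * A by rewrite -mulrDr ler_wpM2l//; lra.
  by rewrite /far Av mulr1; lra.
rewrite !Int_D; try (by repeat apply: intbleD; exact: intbleZ); try exact: intbleZ.
rewrite !Int_Z// => H.
have tl : (l - h x) * Int (fun v => K v * far A v) <= (l - h x) * (Int K / 8).
  by rewrite ler_wpM2l//; lra.
rewrite -(ler_pM2r k0) mulrDl divfK ?gt_eqF//.
have : 0 <= l * Int K by rewrite mulr_ge0// ltW.
have : h x * Int K <= 0 by rewrite mulr_le0_ge0// ltW.
lra.
Qed.

Lemma slowly_decreasing_bounded K h (B M D c x0 : R) :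
  intble K -> intble (fun v => `|v| * K v) -> (forall v, 0 <= K v) -> 0 < Int K ->
  (forall y, intble (fun u => h u * K (u - y)) /\ `|Int (fun u => h u * K (u - y))| <= B) ->
  0 <= M -> 0 <= D ->
  (forall x u, x <= u -> h x - M - D * (u - x) <= h u) ->
  (forall u, u <= x0 -> h u = c) ->
  exists C, forall x, `|h x| <= C.
Proof.
move=> jK jvK K0 k0 HB M0 D0 hd hc.
have [|A A0 tail] := tail_small K (Int K / 8) jK K0; first by rewrite divr_gt0.
have B0 : 0 <= B by have [_] := HB 0; apply: le_trans.
have J0 : 0 <= Int (fun v => `|v| * K v) by apply: Int_ge0 => v; rewrite mulr_ge0.
pose C1 := 2 * (B + (M + D * A) * Int K + D * Int (fun v => `|v| * K v)) / Int K.
pose C2 := 2 * (B + (C1 + 2 * M + D * A) * Int K + D * Int (fun v => `|v| * K v)) / Int K.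
have k1 := ltW k0.
have C10 : 0 <= C1.
  by rewrite /C1; repeat first [assumption|apply: addr_ge0|apply: divr_ge0|apply: mulr_ge0|exact: ler0n].
have C20 : 0 <= C2.
  by rewrite /C2; repeat first [assumption|apply: addr_ge0|apply: divr_ge0|apply: mulr_ge0|exact: ler0n].
have up x l : 0 <= l -> (forall u, u <= x -> - l <= h u) -> h x <= C1 + l / 4.
  move=> l0 hl; apply: (@slowly_decreasing_upper K h A B M D x l) => // u.
  exact: hd.
have lo x l : 0 <= l -> (forall u, u <= x -> - l <= h u) -> - h x <= C2 + l / 2.
  move=> l0 hl; apply: (@slowly_decreasing_lower K h A B M D x l C1) => // [u|u xu].
    exact: hd.
  (* Up to [x] the bound [l] holds; between [x] and [u] the value can fall from [h x >= - l] by at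
     most [M + D * (u - x)]. *)
  apply: up.
    by rewrite !addr_ge0// mulr_ge0// subr_ge0.
  move=> w wu; have [wx|/ltW xw] := lerP w x.
    have := hl _ wx; have : 0 <= D * (u - x) by rewrite mulr_ge0// subr_ge0.
    lra.
  have := hd _ _ xw; have := hl _ (lexx x).
  have : D * (w - x) <= D * (u - x) by rewrite ler_wpM2l//; lra.
  lra.
have low x : - (2 * C2) <= h x.
  (* The supremum is finite because [h] is constant up to [x0] and then drops at most linearly.
     Since [C2] does not depend on [x], absorbing [l / 2] gives a bound uniform in [x]. *)
  pose S := [set - h u | u in [set u | u <= x]]%classic.
  have S0 : S !=set0 by exists (- h x); exists x => /=.
  have Sub : has_ubound S.
    exists (`|c| + M + D * `|x - x0|) => _ [u /= ux <-].
    have p : 0 <= D * `|x - x0| by rewrite mulr_ge0.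
    have cn := ler_norm (- c); rewrite normrN in cn.
    have [ux0|/ltW x0u] := lerP u x0; first by rewrite hc//; lra.
    have := hd _ _ x0u; rewrite hc//.
    have : D * (u - x0) <= D * `|x - x0|.
      by rewrite ler_wpM2l//; have := ler_norm (x - x0); lra.
    lra.
  have hS u : u <= x -> - h u <= sup S by move=> ux; apply: ub_le_sup => //; exists u.
  (* The two estimates want a non-negative level, and the supremum may be negative. *)
  pose l := Num.max 0 (sup S).
  have l0 : 0 <= l by rewrite le_max lexx.
  have Sl : sup S <= l by rewrite le_max lexx orbT.
  have hl u : u <= x -> - l <= h u by move=> ux; have := hS _ ux; lra.
  have : sup S <= C2 + l / 2.
    apply: ge_sup => // _ [u /= ux <-]; apply: lo => // w wu.
    by apply: hl; exact: le_trans ux.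
  have : l = 0 \/ l = sup S by rewrite /l; case: (lerP 0 (sup S)) => _; [right|left].
  by have := hS x (lexx x); move=> H [E|E]; lra.
exists (2 * C2 + C1 + C2) => x; rewrite ler_norml.
have := up x (2 * C2) (mulr_ge0 (ler0n _ 2) C20) (fun u _ => low u).
by have := low x; move=> *; apply/andP; split; lra.
Qed.

Lemma exp_decreasing_bounded K h (B b x0 : R) :
  intble K -> continuous K -> (forall v, 0 <= K v) -> 0 < K 0 ->
  (forall y, intble (fun u => h u * K (u - y)) /\ `|Int (fun u => h u * K (u - y))| <= B) ->
  (forall u, 0 <= h u) -> 0 <= b ->
  (forall x u, x0 <= x -> x <= u -> expR (- (b * (u - x))) * h x <= h u) ->
  exists C, forall x, x0 <= x -> `|h x| <= C.
Proof.
move=> jK cK K0 k0 HB h0 b0 hd.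
have [d d0 Kd] := continuous_pos _ cK k0.
(* A mean centred at [x + d] sees the window from [x] to [x + 2 d], where the kernel is at least
   [K 0 / 2] and [h] has lost at most the exponential factor over the full width. *)
pose q := K 0 / 2 * (d *+ 2) * expR (- (b * (d *+ 2))).
have q0 : 0 < q by rewrite /q !mulr_gt0 ?expR_gt0 ?mulrn_wgt0//; lra.
exists (B / q) => x xx0; rewrite ger0_norm// ler_pdivlMr//.
have [jy Iy] := HB (x + d).
have [jy' Iy'] := Int_shift (x + d) _ jy.
apply: le_trans (le_trans (ler_norm _) Iy); rewrite -Iy'.
rewrite (_ : h x * q = h x * (K 0 / 2) * expR (- (b * (d *+ 2))) * (d *+ 2)); last by rewrite /q; ring.
apply: Int_lower_bound => //; first exact: ltW.
  by move=> v; rewrite mulr_ge0.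
move=> v vd; rewrite addrK mulrAC.
have k2 : 0 <= K 0 / 2 by lra.
apply: ler_pM => //; [by rewrite mulr_ge0// expR_ge0| |exact: Kd].
  have /andP[v1 v2] : - d <= v <= d by rewrite -ler_norml.
  have xv : x <= v + (x + d) by lra.
  apply: le_trans (hd _ _ xx0 xv); rewrite mulrC ler_wpM2r// ler_expR lerN2.
  by rewrite ler_wpM2l//; lra.
Qed.

End Tauberian.
(** * Laplace transforms with a one-sided bound *)

Section Laplace.
Context {R : realType}.
Implicit Types (g f K : R -> R).
Local Notation mu := (@lebesgue_measure R).

Lemma intble_lin_expN (s A : R) : 0 < s -> intble (fun u => A * ((1 + `|u|) * expR (- (s * `|u|)))).
Proof.
move=> s0; apply: intbleZ; have s2 : 0 < s / 2 by lra.
have [je _] := Int_expN _ s2.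
(* Half of the exponential absorbs the linear factor through [1 + y <= expR y]; the other half
   remains for integrability. *)
apply: (@intble_le _ _ (fun u => (1 + 2 / s) * expR (- (s / 2 * `|u|)))); last first.
- move=> u; rewrite ger0_norm; last by rewrite mulr_ge0 ?expR_ge0 ?addr_ge0.
  rewrite (_ : expR (- (s * `|u|)) = expR (- (s / 2 * `|u|)) * expR (- (s / 2 * `|u|))); last first.
    by rewrite -expRD; congr expR; field.
  rewrite mulrA ler_wpM2r ?expR_ge0// expRN ler_pdivrMr ?expR_gt0//.
  have h := expR_ge1Dx (s / 2 * `|u|).
  have y0 : 0 <= s / 2 * `|u| by rewrite mulr_ge0// ltW.
  rewrite (_ : 1 + `|u| = 1 + 2 / s * (s / 2 * `|u|)); last by field; rewrite gt_eqF.
  have t0 : 0 <= 2 / s by rewrite divr_ge0// ltW.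
  apply: le_trans (_ : (1 + 2 / s) * (1 + s / 2 * `|u|) <= _); last by rewrite ler_wpM2l//; lra.
  by rewrite mulrDl mul1r mulrDr mulr1; have := mulr_ge0 t0 y0; lra.
- exact: intbleZ.
- apply: measurable_funM; last exact: continuous_meas (continuous_expN s).
  by apply: measurable_funD => //; exact: continuous_meas (@norm_continuous _ R).
Qed.

Definition loc_intble g := forall a b : R, mu.-integrable `[a, b] (EFin \o g).

Lemma patch_indic g (A : set R) : g \_ A = fun u => g u * \1_A u.
Proof. by apply/funext => u; rewrite patchE indicE; case: (u \in A); rewrite ?mulr1 ?mulr0. Qed.

Lemma loc_intble_indic g (a b : R) : loc_intble g -> intble (fun u => g u * \1_(`[a, b]%classic : set R) u).
Proof.
move=> lg; rewrite -patch_indic /intble.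
rewrite -restrict_EFin; apply: iffLR (lg a b); apply: integrable_mkcond.
exact: measurable_itv.
Qed.

Lemma loc_intble_meas g : loc_intble g -> measurable_fun setT g.
Proof.
move=> lg; apply: (@measurable_fun_cvg _ _ _ _ (fun n (u : R) => g u * \1_(`[- n%:R, n%:R]%classic : set R) u)).
  by move=> n; exact: intble_meas _ (loc_intble_indic g (- n%:R) n%:R lg).
move=> u _; apply: cvg_near_cst; near=> n.
rewrite indicE mem_set ?mulr1//= in_itv/= -ler_norml.
by near: n; exact: nbhs_infty_ger.
Unshelve. all: by end_near. Qed.

(* The one-sided bound that both Tauberian conditions provide; it is what makes
   the improper Laplace integral absolutely convergent. *)
Definition lower_linear g (x0 A : R) := forall u, x0 <= u -> - (A * (1 + u)) <= g u.

(** Covers the stretch before the one-sided bound sets in; together with the linear bound it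
    minorizes [g] on the whole line. *)
Definition cut g (x0 u : R) := `|g u| * \1_(`[0, x0]%classic : set R) u.

Lemma lower_linear_minorant g (x0 A u : R) : (forall x, x < 0 -> g x = 0) ->
  0 <= A -> lower_linear g x0 A -> - (cut g x0 u + A * (1 + `|u|)) <= g u.
Proof.
move=> g0 A0 lg; have p : 0 <= A * (1 + `|u|) by rewrite mulr_ge0// addr_ge0.
have c0 : 0 <= cut g x0 u by rewrite mulr_ge0.
have [u0|u0] := ltrP u 0; first by rewrite g0//; lra.
have [x0u|ux0] := lerP x0 u; first by have := lg _ x0u; rewrite (ger0_norm u0) in p *; lra.
have -> : cut g x0 u = `|g u|.
  by rewrite /cut indicE mem_set ?mulr1//= in_itv/= u0 ltW.
by have := ler_norm (- g u); rewrite normrN; lra.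
Qed.

Lemma intble_cut g (x0 : R) : loc_intble g -> intble (cut g x0).
Proof.
move=> lg; have := intble_norm _ (loc_intble_indic _ 0 x0 lg).
by congr intble; apply/funext => u; rewrite /cut normrM [X in _ * X]ger0_norm.
Qed.

(** Symmetric cut-offs tend to 1 at every real point, as the convergence lemmas on the whole line
    require. *)
Lemma Int_cut_interval (f : R -> R) (T : R) : (forall x, x < 0 -> f x = 0) ->
  Int (fun u => f u * \1_(`[- T, T]%classic : set R) u) = \int[mu]_(u in `[0, T]) f u.
Proof.
move=> f0; rewrite Rintegral_mkcond patch_indic; apply: Int_eq => u.
have [u0|u0] := ltrP u 0; first by rewrite f0// !mul0r.
rewrite !indicE (_ : (u \in `[- T, T]%classic) = (u \in `[0, T]%classic))//.
apply/idP/idP; rewrite !inE/= !in_itv/=.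
  by move=> /andP[_ ->]; rewrite u0.
by move=> /andP[_ uT]; rewrite uT andbT; lra.
Qed.

Lemma cvg_interval_n (f : R -> R) (l : R) : (forall x, x < 0 -> f x = 0) ->
  \int[mu]_(u in `[0, T]) f u @[T --> +oo] --> l ->
  (fun n : nat => Int (fun u => f u * \1_(`[- n%:R, n%:R]%classic : set R) u)) @ \oo --> l.
Proof.
move=> f0 cl.
rewrite (_ : (fun n => _) = (fun T => \int[mu]_(u in `[0, T]) f u) \o (fun n : nat => n%:R)).
  exact: cvg_comp (@cvgr_idn R) cl.
by apply/funext => n /=; rewrite Int_cut_interval.
Qed.

Lemma cvg_indic_n (u : R) : (fun n : nat => \1_(`[- n%:R, n%:R]%classic : set R) u) @ \oo --> (1 : R).
Proof.
apply: cvg_near_cst; near=> n.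
rewrite indicE mem_set//= in_itv/= -ler_norml.
by near: n; exact: nbhs_infty_ger.
Unshelve. all: by end_near. Qed.

Lemma indic_01 (A : set R) u : 0 <= (\1_A u : R) <= 1.
Proof. by rewrite indicE; case: (_ \in _); rewrite /= ?lexx ?ler01. Qed.

(** [Int_one_sided] with cut-offs as weights; the linear minorant becomes integrable against the
    exponential. Writing the weight with the absolute value of [u] keeps it bounded on the whole
    line and changes nothing where [g] lives. *)
Lemma laplace_abs g (x0 A s : R) : loc_intble g -> (forall x, x < 0 -> g x = 0) ->
  0 <= A -> lower_linear g x0 A -> 0 < s ->
  cvg (\int[mu]_(u in `[0, T]) (g u * expR (- (s * u))) @[T --> +oo]) ->
  intble (fun u => g u * expR (- (s * `|u|))).
Proof.
move=> lg g0 A0 lin s0 /cvg_ex[l cl].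
have mg := loc_intble_meas _ lg.
have me := continuous_meas _ (continuous_expN s).
have cE (u : R) : 0 <= expR (- (s * `|u|)) <= 1.
  by rewrite expR_ge0 expR_le1 oppr_le0 mulr_ge0// ltW.
have jn n : intble (fun u => g u * expR (- (s * `|u|)) * \1_(`[- n%:R, n%:R]%classic : set R) u).
  have := @intbleM _ 1 _ _ (loc_intble_indic _ (- n%:R) n%:R lg) me.
  have -> : (fun u => g u * expR (- (s * `|u|)) * \1_(`[- n%:R, n%:R]%classic : set R) u) =
    (fun u => g u * \1_(`[- n%:R, n%:R]%classic : set R) u * expR (- (s * `|u|))).
    by apply/funext => u; rewrite mulrAC.
  by apply=> u; have /andP[e0 e1] := cE u; rewrite ger0_norm.
have jp := intbleD _ _ (intble_cut _ x0 lg) (intble_lin_expN s A s0).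
have z x : x < 0 -> g x * expR (- (s * `|x|)) = 0 by move=> x_lt0; rewrite g0 ?mul0r.
have cn := @cvg_interval_n (fun u => g u * expR (- (s * `|u|))) l z.
have [] := @Int_one_sided _ (fun n u => \1_(`[- n%:R, n%:R]%classic : set R) u)
  (fun u => g u * expR (- (s * `|u|))) _ l _ _ _ _ jp _ _ jn _ => //.
- by move=> n; exact: measurable_indic.
- by move=> n u; exact: indic_01.
- exact: cvg_indic_n.
- exact: measurable_funM.
- move=> u; have /andP[e0 _] := cE u.
  by rewrite addr_ge0 ?mulr_ge0// ?addr_ge0.
- move=> u; have /andP[e0 e1] := cE u.
  have H := lower_linear_minorant _ _ _ u g0 A0 lin.
  have := ler_wpM2r e0 H; rewrite mulNr mulrDl -(mulrA A).
  have : cut g x0 u * expR (- (s * `|u|)) <= cut g x0 u by rewrite ler_piMr// mulr_ge0.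
  lra.
- apply: cn; rewrite (_ : (fun T => _) = (fun T => \int[mu]_(u in `[0, T]) (g u * expR (- (s * u)))))//.
  apply/funext => T; apply: eq_Rintegral => u; rewrite inE/= in_itv/= => /andP[u0 _].
  by rewrite ger0_norm.
Qed.

Lemma lim_interval (f : R -> R) : intble f -> (forall x, x < 0 -> f x = 0) ->
  cvg (\int[mu]_(u in `[0, T]) f u @[T --> +oo]) ->
  lim (\int[mu]_(u in `[0, T]) f u @[T --> +oo]) = Int f.
Proof.
move=> jf f0 /cvg_ex[l cl]; rewrite (cvg_lim _ cl)//.
have [_ L] : intble f /\
    (fun n : nat => Int (fun u => f u * \1_(`[- n%:R, n%:R]%classic : set R) u)) @ \oo --> Int f.
  apply: (@Int_dct _ _ _ (fun u => `|f u|)).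
  - by move=> n; apply: measurable_funM; [exact: intble_meas|exact: measurable_indic].
  - by move=> u; rewrite -[X in _ --> X]mulr1; apply: cvgM; [exact: cvg_cst|exact: cvg_indic_n].
  - exact: intble_norm.
  - move=> n u; have /andP[i0 i1] := indic_01 `[- n%:R, n%:R]%classic u.
    by rewrite normrM ler_piMr// ger0_norm.
exact: cvg_unique (cvg_interval_n _ _ f0 cl) L.
Qed.

(** After Fubini the inner integral over [t] is a cosine or sine transform of [f] at [u - x].
    Evenness kills the sine, and with it [a2]: this decouples the two components of [tau]. *)
Lemma kernel_pairing (f a1 a2 : R -> R) (x : R) : bump f -> (forall t, f (- t) = f t) ->
  intble a1 -> intble a2 ->
  Int (fun t => f t * Int (fun u => a1 u * cos (t * (u - x)) + a2 u * sin (t * (u - x)))) =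
  Int (fun u => a1 u * fcos f (u - x)).
Proof.
move=> bf ef j1 j2.
have m1 := intble_meas _ j1; have m2 := intble_meas _ j2.
have mf := continuous_meas _ (bump_continuous _ bf).
have mp (g : R -> R) : continuous g -> measurable_fun setT (fun z : R * R => g (z.1 * (z.2 - x))).
  move=> cg; apply: (measurableT_comp (continuous_meas _ cg)).
  by apply: measurable_funM; [exact: measurable_fst|apply: measurable_funB => //; exact: measurable_snd].
have jc (g : R -> R) (a : R -> R) t : intble a -> continuous g -> (forall y, `|g y| <= 1) -> intble (fun u => a u * g (t * (u - x))).
  move=> ja cg g1; apply: (@intbleM _ 1) => //.
  apply: (measurableT_comp (continuous_meas _ cg)).
  by apply: measurable_funM => //; exact: measurable_funB.
transitivity (Int (fun t => Int (fun u => f t * (a1 u * cos (t * (u - x)) + a2 u * sin (t * (u - x)))))).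
  apply: Int_eq => t; rewrite -Int_Z//; apply: intbleD; apply: jc => //.
  - exact: continuous_cos.
  - exact: cos_max.
  - exact: continuous_sin.
  - exact: sin_max.
rewrite (Int_fubini _ (fun t => `|f t|) (fun u => `|a1 u| + `|a2 u|)); last 4 first.
- apply: measurable_funM; first by apply: (measurableT_comp mf); exact: measurable_fst.
  apply: measurable_funD; apply: measurable_funM.
  + by apply: (measurableT_comp m1); exact: measurable_snd.
  + exact: (mp cos (@continuous_cos R)).
  + by apply: (measurableT_comp m2); exact: measurable_snd.
  + exact: (mp sin (@continuous_sin R)).
- exact/intble_norm/bump_intble.
- by apply: intbleD; exact: intble_norm.
- move=> t u; rewrite normrM ler_wpM2l// (le_trans (ler_normD _ _))//.
  by rewrite lerD// normrM ler_piMr// ?cos_max ?sin_max.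
apply: Int_eq => u.
rewrite (Int_eq _ (fun t => a1 u * (f t * cos ((u - x) * t)) + a2 u * (f t * sin ((u - x) * t)))); last first.
  by move=> t; rewrite (mulrC t); ring.
have b1 := bump_intble _ (bump_cos _ (u - x) bf); have b2 := bump_intble _ (bump_sin _ (u - x) bf).
rewrite Int_D; [|exact: intbleZ..].
by rewrite !Int_Z// -/(fsin f (u - x)) fsin_even// mulr0 addr0.
Qed.

(** [Int_one_sided] a second time, now with the exponentials as weights. The linear minorant times
    the kernel is integrable because [1 + |u| <= (1 + |y|) + |u - y|] and [K] has a finite first
    moment. *)
Lemma kernel_means_bounded g (x0 A l y : R) K : loc_intble g -> (forall x, x < 0 -> g x = 0) ->
  0 <= A -> lower_linear g x0 A ->
  (forall s, 0 < s -> intble (fun u => g u * expR (- (s * `|u|)))) ->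
  continuous K -> (forall v, 0 <= K v) -> (exists M, forall v, `|K v| <= M) ->
  intble K -> intble (fun v => `|v| * K v) ->
  (fun n : nat => Int (fun u => g u * expR (- (n.+1%:R^-1 * `|u|)) * K (u - y))) @ \oo --> l ->
  intble (fun u => g u * K (u - y)) /\ Int (fun u => g u * K (u - y)) = l.
Proof.
move=> lg g0 A0 lin jg cK K0 [M KM] jK jvK cl.
have mg := loc_intble_meas _ lg.
have mK : measurable_fun setT (fun u : R => K (u - y)).
  by apply: (measurableT_comp (continuous_meas _ cK)); exact: measurable_funB.
have e0 n : 0 < n.+1%:R^-1 :> R by rewrite invr_gt0.
have E01 n (u : R) : 0 <= expR (- (n.+1%:R^-1 * `|u|)) <= 1.
  by rewrite expR_ge0 expR_le1 oppr_le0 mulr_ge0// ltW.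
have [jKy _] := Int_shift (- y) _ jK.
have [jvKy _] := Int_shift (- y) _ jvK.
have ce : (fun n : nat => n.+1%:R^-1 : R) @ \oo --> (0 : R) by exact: cvg_harmonic.
have jp : intble (fun u => M * cut g x0 u + (A * (1 + `|y|) * K (u - y) + A * (`|u - y| * K (u - y)))).
  by apply: intbleD; [exact/intbleZ/intble_cut|apply: intbleD; exact: intbleZ].
have cut0 u : 0 <= cut g x0 u by rewrite mulr_ge0.
have M0 : 0 <= M by exact: le_trans (KM 0).
apply: (@Int_one_sided _ (fun n u => expR (- (n.+1%:R^-1 * `|u|))) _ _ l _ E01 _ _ jp).
- by move=> n; exact: continuous_meas (continuous_expN _).
- by move=> u; exact: cvg_expN_1.
- exact: measurable_funM.
- by move=> u; repeat first [assumption|exact: cut0|exact: K0|exact: normr_ge0|exact: ler01|apply: addr_ge0|apply: mulr_ge0].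
- move=> u; have H := ler_wpM2r (K0 (u - y)) (lower_linear_minorant _ _ _ u g0 A0 lin).
  apply: le_trans H; rewrite mulNr lerN2 mulrDl; apply: lerD.
    by rewrite mulrC ler_wpM2r// (le_trans (ler_norm _)).
  rewrite mulrA -mulrDl ler_wpM2r// -mulrDr ler_wpM2l//.
  by have := ler_normD (u - y) y; rewrite subrK; lra.
- move=> n; have := @intbleM _ M _ _ (jg _ (e0 n)) mK (fun u => KM (u - y)).
  by congr intble; apply/funext => u; rewrite mulrAC.
rewrite (_ : (fun n => _) = (fun n : nat => Int (fun u => g u * expR (- (n.+1%:R^-1 * `|u|)) * K (u - y))))//.
by apply/funext => n; apply: Int_eq => u; rewrite mulrAC.
Qed.

End Laplace.
(** * Pseudomeasure boundary behavior *)

Section Main.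
Context {R : realType}.
Implicit Types (g f K : R -> R) (tau : R -> R[i]).
Local Notation mu := (@lebesgue_measure R).

(** Chaining steps of length [d], each losing at most the absolute value of [M]: the distance
    [u - x] takes at most [(u - x) / d + 1] steps. *)
Lemma bdd_decreasing_linear g : bdd_decreasingR g -> exists x0 M D, [/\ 0 <= x0, 0 <= M, 0 <= D &
  forall x u, x0 <= x -> x <= u -> g x - M - D * (u - x) <= g u].
Proof.
move=> [d d0 [M [x1 [_ H]]]].
(* The hypothesis holds strictly beyond [x1], whose sign is unknown. *)
exists (`|x1| + 1), `|M|, (`|M| / d); split; rewrite ?addr_ge0 ?divr_ge0 ?(ltW d0)//.
move=> x u x0x xu.
have step n v : x <= v -> v <= x + n.+1%:R * d -> g x - n.+1%:R * `|M| <= g v.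
  elim: n v => [|n IH] v xv vx.
    have x1x : x1 < x by have := ler_norm x1; lra.
    have h01 : 0 <= v - x <= d by apply/andP; split; lra.
    have := H _ x1x _ h01; rewrite (_ : x + (v - x) = v); last by ring.
    by have := ler_norm M; lra.
  have nn : 0 <= n.+1%:R * `|M| by rewrite mulr_ge0.
  rewrite -(natr1 n.+1) mulrDl mul1r in vx *.
  have [vd|dv] := lerP v (x + n.+1%:R * d); first by have := IH _ xv vd; have := normr_ge0 M; lra.
  have nd : 0 <= n.+1%:R * d by rewrite mulr_ge0// ltW.
  have := IH (x + n.+1%:R * d) _ (lexx _); rewrite lerDl => /(_ nd) H1.
  have x1x : x1 < x + n.+1%:R * d by have := ler_norm x1; lra.
  have h01 : 0 <= v - (x + n.+1%:R * d) <= d by apply/andP; split; lra.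
  have := H _ x1x _ h01; rewrite (_ : x + _ + _ = v); last by ring.
  by have := ler_norm M; lra.
have q0 : 0 <= (u - x) / d by rewrite divr_ge0 ?subr_ge0// ltW.
have /andP[n1 n2] := Num.Theory.truncn_itv q0.
have := step (Num.truncn ((u - x) / d)) u xu.
have : u - x <= (Num.truncn ((u - x) / d)).+1%:R * d by rewrite -ler_pdivrMr// ltW.
move=> ud /(_ ltac:(lra)).
have : ((Num.truncn ((u - x) / d)).+1%:R * `|M| <= ((u - x) / d + 1) * `|M|).
  by rewrite ler_wpM2r// -natr1 lerD2r.
rewrite [(_ + 1) * _]mulrDl mul1r (_ : (u - x) / d * `|M| = `|M| / d * (u - x)); last by ring.
lra.
Qed.

(** The real form of the second Tauberian condition, with a non-negative rate. An eventually
    vanishing function satisfies it, so it fits the imaginary part as well. *)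
Definition exp_decreasing g := exists x0 b : R, [/\ 0 <= x0, 0 <= b, forall x, x0 <= x -> 0 <= g x &
  forall x u, x0 <= x -> x <= u -> expR (- (b * (u - x))) * g x <= g u].

Lemma tauberian_lower_linear g : bdd_decreasingR g \/ exp_decreasing g ->
  exists x0 A, 0 <= A /\ lower_linear g x0 A.
Proof.
move=> [/bdd_decreasing_linear[x0 [M [D [x00 M0 D0 H]]]]|[x0 [b [_ _ g0 _]]]]; last first.
  by exists x0, 0; split=> // u /g0; rewrite mul0r oppr0.
exists x0, (`|g x0| + M + D); split; first by rewrite !addr_ge0.
move=> u x0u; have := H _ _ (lexx x0) x0u.
have g0 := ler_norm (- g x0); rewrite normrN in g0; have gn := normr_ge0 (g x0).
have : 0 <= (`|g x0| + M) * u by rewrite mulr_ge0 ?addr_ge0//; lra.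
have : 0 <= D * x0 by rewrite mulr_ge0.
by rewrite mulrBr !mulrDr !mulr1 !mulrDl; lra.
Qed.

(** Freezing [g] at the value [g x0] to the left of [x0] turns an eventual Tauberian condition into
    one on the whole line. The means change by a bounded amount, since [g] is locally integrable and
    vanishes on the negative axis. *)
Lemma extend_left_means g (x0 B : R) K : loc_intble g -> (forall x, x < 0 -> g x = 0) ->
  continuous K -> (forall v, 0 <= K v) -> (exists M, forall v, `|K v| <= M) -> intble K ->
  (forall y, intble (fun u => g u * K (u - y)) /\ `|Int (fun u => g u * K (u - y))| <= B) ->
  exists B', forall y, intble (fun u => g (Num.max u x0) * K (u - y)) /\
    `|Int (fun u => g (Num.max u x0) * K (u - y))| <= B'.
Proof.
move=> lg g0 cK K0 [Mk KM] jK HB.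
have mg := loc_intble_meas _ lg.
exists (B + (`|g x0| * Int K + Mk * Int (cut g x0))) => y.
have [jKy IKy] := Int_shift (- y) _ jK.
have [jgy Igy] := HB y.
have mh : measurable_fun setT (fun u : R => g (Num.max u x0)).
  by apply: (measurableT_comp mg); apply: measurable_maxr.
have mK : measurable_fun setT (fun u : R => K (u - y)).
  by apply: (measurableT_comp (continuous_meas _ cK)); exact: measurable_funB.
have jb : intble (fun u => `|g x0| * K (u - y) + Mk * cut g x0 u).
  by apply: intbleD; apply: intbleZ => //; exact: intble_cut.
have Mk0 : 0 <= Mk by exact: le_trans (KM 0).
have bd u : `|(g (Num.max u x0) - g u) * K (u - y)| <= `|g x0| * K (u - y) + Mk * cut g x0 u.
  have c0 : 0 <= Mk * cut g x0 u by rewrite mulr_ge0// mulr_ge0.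
  have p0 : 0 <= `|g x0| * K (u - y) by rewrite mulr_ge0.
  have [x0u|ux0] := lerP x0 u.
    by rewrite subrr mul0r normr0; lra.
  rewrite normrM (ger0_norm (K0 _)).
  apply: (le_trans (ler_wpM2r (K0 _) (ler_normB _ _))); rewrite mulrDl lerD2l.
  have [u0|u0] := ltrP u 0; first by rewrite g0// normr0 mul0r.
  have -> : cut g x0 u = `|g u|.
    by rewrite /cut indicE mem_set ?mulr1//= in_itv/= u0 ltW.
  by rewrite mulrC ler_wpM2r// (le_trans (ler_norm _)).
have jd : intble (fun u => (g (Num.max u x0) - g u) * K (u - y)).
  apply: (intble_le _ _ _ jb bd); apply: measurable_funM => //; exact: measurable_funB.
have E u : g (Num.max u x0) * K (u - y) = g u * K (u - y) + (g (Num.max u x0) - g u) * K (u - y) by ring.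
split.
  by have := intbleD _ _ jgy jd; congr intble; apply/funext => u; rewrite -E.
rewrite (Int_eq _ _ E) Int_D//; apply: (le_trans (ler_normD _ _)); apply: lerD => //.
apply: (le_trans (Int_bound _ _ jd jb bd)).
by rewrite Int_D ?Int_Z ?IKy//; try (apply: intbleZ => //); exact: intble_cut.
Qed.

Lemma tauberian_bounded g (B : R) K : loc_intble g -> (forall x, x < 0 -> g x = 0) ->
  continuous K -> (forall v, 0 <= K v) -> (exists M, forall v, `|K v| <= M) -> intble K ->
  intble (fun v => `|v| * K v) -> 0 < K 0 ->
  (forall y, intble (fun u => g u * K (u - y)) /\ `|Int (fun u => g u * K (u - y))| <= B) ->
  bdd_decreasingR g \/ exp_decreasing g ->
  exists x0 C, forall x, x0 <= x -> `|g x| <= C.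
Proof.
move=> lg g0 cK K0 bK jK jvK Kpos HB.
move=> [/bdd_decreasing_linear[x0 [M [D [x00 M0 D0 H]]]]|[x0 [b [x00 b0 gp H]]]].
  have [B' HB'] := extend_left_means g x0 B K lg g0 cK K0 bK jK HB.
  have IK0 : 0 < Int K.
    have [d d0 Kd] := continuous_pos _ cK Kpos.
    apply: lt_le_trans (Int_lower_bound _ _ _ jK (ltW d0) K0 Kd).
    by rewrite mulr_gt0 ?mulrn_wgt0//; lra.
  have [||C HC] := @slowly_decreasing_bounded _ K (fun u => g (Num.max u x0)) B' M D (g x0) x0 jK jvK K0 IK0 HB' M0 D0.
  - move=> x u xu; have [ux0|x0u] := lerP u x0.
      rewrite max_r; last exact: le_trans ux0.
      have : 0 <= D * (u - x) by rewrite mulr_ge0// subr_ge0.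
      lra.
    have [xx0|x0x] := lerP x x0.
      have := H _ _ (lexx x0) (ltW x0u).
      have : D * (u - x0) <= D * (u - x) by rewrite ler_wpM2l//; lra.
      lra.
    by apply: H => //; exact: ltW.
  - by move=> u ux0; rewrite max_r.
  by exists x0, C => x x0x; have := HC x; rewrite max_l.
have [B' HB'] := extend_left_means g x0 B K lg g0 cK K0 bK jK HB.
have [| |C HC] := @exp_decreasing_bounded _ K (fun u => g (Num.max u x0)) B' b x0 jK cK K0 Kpos HB' _ b0.
- by move=> u; apply: gp; rewrite le_max lexx orbT.
- by move=> x u x0x xu; rewrite !max_l//; [exact: H|exact: le_trans xu].
by exists x0, C => x x0x; have := HC x x0x; rewrite max_l.
Qed.

(** * Pairing the Laplace transform with modulated bumps *)

Lemma laplace_integrand tau (s t x : R) :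
  cRe (tau x * cexp (- ((s +i* t) * x%:C))) =
    (cRe (tau x) * cos (t * x) + cIm (tau x) * sin (t * x)) * expR (- (s * x)) /\
  cIm (tau x * cexp (- ((s +i* t) * x%:C))) =
    (cIm (tau x) * cos (t * x) - cRe (tau x) * sin (t * x)) * expR (- (s * x)).
Proof.
case: (tau x) => a b; rewrite /cexp /cRe /cIm /= !mulr0 subr0 add0r cosN sinN.
by split; ring.
Qed.

Lemma laplace_partial_parts tau (s t T : R) :
  cRe (laplace_partial tau (s +i* t) T) = \int[mu]_(x in `[0, T])
    ((cRe (tau x) * cos (t * x) + cIm (tau x) * sin (t * x)) * expR (- (s * `|x|))) /\
  cIm (laplace_partial tau (s +i* t) T) = \int[mu]_(x in `[0, T])
    ((cIm (tau x) * cos (t * x) - cRe (tau x) * sin (t * x)) * expR (- (s * `|x|))).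
Proof.
split; apply: eq_Rintegral => x; rewrite inE/= in_itv/= => /andP[x0 _];
  rewrite (ger0_norm x0); have [H1 H2] := laplace_integrand tau s t x; [exact: H1|exact: H2].
Qed.

Lemma intble_trig_mod (a : R -> R) (t : R) : intble a ->
  intble (fun u => a u * cos (t * u)) /\ intble (fun u => a u * sin (t * u)).
Proof.
move=> ja; split; apply: (@intbleM _ 1) => //.
- exact: continuous_meas (continuous_cosM _).
- by move=> u; exact: cos_max.
- exact: continuous_meas (continuous_sinM _).
- by move=> u; exact: sin_max.
Qed.

Lemma laplaceT_parts tau (s t : R) : (forall x, x < 0 -> tau x = 0) ->
  intble (fun u => cRe (tau u) * expR (- (s * `|u|))) ->
  intble (fun u => cIm (tau u) * expR (- (s * `|u|))) ->
  laplace_converges tau (s +i* t) ->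
  cRe (laplaceT tau (s +i* t)) =
    Int (fun u => (cRe (tau u) * cos (t * u) + cIm (tau u) * sin (t * u)) * expR (- (s * `|u|))) /\
  cIm (laplaceT tau (s +i* t)) =
    Int (fun u => (cIm (tau u) * cos (t * u) - cRe (tau u) * sin (t * u)) * expR (- (s * `|u|))).
Proof.
move=> t0 j1 j2 [c1 c2].
have [jc1 js1] := intble_trig_mod _ t j1; have [jc2 js2] := intble_trig_mod _ t j2.
have E1 : (fun T => cRe (laplace_partial tau (s +i* t) T)) = (fun T => \int[mu]_(x in `[0, T])
    ((cRe (tau x) * cos (t * x) + cIm (tau x) * sin (t * x)) * expR (- (s * `|x|)))).
  by apply/funext => T; have [] := laplace_partial_parts tau s t T.
have E2 : (fun T => cIm (laplace_partial tau (s +i* t) T)) = (fun T => \int[mu]_(x in `[0, T])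
    ((cIm (tau x) * cos (t * x) - cRe (tau x) * sin (t * x)) * expR (- (s * `|x|)))).
  by apply/funext => T; have [] := laplace_partial_parts tau s t T.
rewrite E1 in c1; rewrite E2 in c2.
split; rewrite /laplaceT /cRe /cIm /= -/(cRe _) -/(cIm _).
  rewrite -[X in lim (X @ _)]/(fun T => cRe (laplace_partial tau (s +i* t) T)) E1.
  apply: lim_interval c1 => [|x x0]; last by rewrite t0// !mul0r addr0 mul0r.
  by have := intbleD _ _ jc1 js2; congr intble; apply/funext => u; ring.
rewrite -[X in lim (X @ _)]/(fun T => cIm (laplace_partial tau (s +i* t) T)) E2.
apply: lim_interval c2 => [|x x0]; last by rewrite t0// !mul0r subr0 mul0r.
by have := intbleB _ _ jc2 js1; congr intble; apply/funext => u; ring.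
Qed.

(** This is [2 pi f(t) e^{itx}]. The factor [2 pi] makes it exactly the Fourier transform of a
    translate of [fcos f] for even [f], the form in which a pseudomeasure can be evaluated. *)
Definition wave f (x : R) : R -> R[i] :=
  fun t => (2 * pi * f t * cos (t * x)) +i* (2 * pi * f t * sin (t * x)).

Lemma laplace_wave_pairing tau f (s x : R) : bump f -> (forall t, f (- t) = f t) ->
  (forall x, x < 0 -> tau x = 0) ->
  intble (fun u => cRe (tau u) * expR (- (s * `|u|))) ->
  intble (fun u => cIm (tau u) * expR (- (s * `|u|))) ->
  (forall t, laplace_converges tau (s +i* t)) ->
  cRe (cint setT (fun t => laplaceT tau (s +i* t) * wave f x t)) =
    2 * pi * Int (fun u => cRe (tau u) * expR (- (s * `|u|)) * fcos f (u - x)) /\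
  cIm (cint setT (fun t => laplaceT tau (s +i* t) * wave f x t)) =
    2 * pi * Int (fun u => cIm (tau u) * expR (- (s * `|u|)) * fcos f (u - x)).
Proof.
move=> bf ef t0 j1 j2 lc.
pose a1 u := cRe (tau u) * expR (- (s * `|u|)); pose a2 u := cIm (tau u) * expR (- (s * `|u|)).
have bc : bump (fun t => 2 * pi * f t).
  have := bumpM _ _ bf (smooth_cst (2 * pi)); congr bump; apply/funext => t; ring.
have ec t : 2 * pi * f (- t) = 2 * pi * f t by rewrite ef.
have fc v : fcos (fun t => 2 * pi * f t) v = 2 * pi * fcos f v.
  by rewrite /fcos -Int_Z; [apply: Int_eq => t; ring|exact/bump_intble/bump_cos].
(* The real part of the Laplace transform times [e^{itx}], with the modulation moved under the
   integral. *)
have shiftE (b1 b2 : R -> R) t : intble b1 -> intble b2 ->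
    Int (fun u => b1 u * cos (t * (u - x)) + b2 u * sin (t * (u - x))) =
    Int (fun u => b1 u * cos (t * u) + b2 u * sin (t * u)) * cos (t * x) -
    Int (fun u => b2 u * cos (t * u) - b1 u * sin (t * u)) * sin (t * x).
  move=> jb1 jb2.
  have [jc1 js1] := intble_trig_mod _ t jb1; have [jc2 js2] := intble_trig_mod _ t jb2.
  rewrite mulrC [X in _ - X]mulrC -!Int_Z; [|exact: intbleB|exact: intbleD].
  rewrite -Int_B; [|exact/intbleZ/intbleD|exact/intbleZ/intbleB].
  by apply: Int_eq => u; rewrite mulrBr cosB sinB; ring.
have HL t := laplaceT_parts tau s t t0 j1 j2 (lc t).
have R1 t : cRe (laplaceT tau (s +i* t)) = Int (fun u => a1 u * cos (t * u) + a2 u * sin (t * u)).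
  by have [-> _] := HL t; apply: Int_eq => u; rewrite /a1 /a2; ring.
have R2 t : cIm (laplaceT tau (s +i* t)) = Int (fun u => a2 u * cos (t * u) - a1 u * sin (t * u)).
  by have [_ ->] := HL t; apply: Int_eq => u; rewrite /a1 /a2; ring.
have jN1 := intbleN _ j1.
split.
  transitivity (Int (fun t => 2 * pi * f t * Int (fun u => a1 u * cos (t * (u - x)) + a2 u * sin (t * (u - x))))).
    apply: Int_eq => t; rewrite shiftE// -R1 -R2 /comp.
    by case: (laplaceT tau (s +i* t)) => p q; rewrite /wave /cRe /cIm /=; ring.
  rewrite (kernel_pairing (fun t => 2 * pi * f t) a1 a2 x bc ec j1 j2).
  rewrite -Int_Z; first by apply: Int_eq => u; rewrite fc /a1; ring.
  have [M KM] := trig_bounded _ (fcos_trig _ bf).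
  apply: (@intbleM _ M) => //.
  apply: (@measurableT_comp _ _ _ _ _ _ (fcos f)); last exact: measurable_funB.
  exact: continuous_meas (smooth_continuous _ (trig_smooth _ (fcos_trig _ bf))).
(* The imaginary part is the real part after multiplication by [-i], which turns the pair [(a1, a2)]
   into [(a2, - a1)]. *)
transitivity (Int (fun t => 2 * pi * f t * Int (fun u => a2 u * cos (t * (u - x)) + (- a1 u) * sin (t * (u - x))))).
  apply: Int_eq => t; rewrite shiftE//.
  rewrite (Int_eq (fun u => a2 u * cos (t * u) + - a1 u * sin (t * u)) (fun u => a2 u * cos (t * u) - a1 u * sin (t * u))); last first.
    by move=> u; ring.
  rewrite (Int_eq (fun u => - a1 u * cos (t * u) - a2 u * sin (t * u)) (fun u => - (a1 u * cos (t * u) + a2 u * sin (t * u)))); last first.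
    by move=> u; ring.
  rewrite Int_N; last first.
    by apply: intbleD; [have [] := intble_trig_mod _ t j1|have [] := intble_trig_mod _ t j2].
  rewrite -R1 -R2 /comp.
  by case: (laplaceT tau (s +i* t)) => p q; rewrite /wave /cRe /cIm /=; ring.
rewrite (kernel_pairing (fun t => 2 * pi * f t) a2 (fun u => - a1 u) x bc ec j2 jN1).
rewrite -Int_Z; first by apply: Int_eq => u; rewrite fc /a2; ring.
have [M KM] := trig_bounded _ (fcos_trig _ bf).
apply: (@intbleM _ M) => //.
apply: (@measurableT_comp _ _ _ _ _ _ (fcos f)); last exact: measurable_funB.
exact: continuous_meas (smooth_continuous _ (trig_smooth _ (fcos_trig _ bf))).
Qed.

Lemma wave_fourierT f (x : R) : bump f -> (forall t, f (- t) = f t) ->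
  fourierT (fun u => (fcos f (u + x))%:C) = wave f x.
Proof.
move=> bf ef; apply/funext => t; have [H1 H2] := kernel_fourier f t x bf ef.
rewrite /fourierT /cint /wave; congr (_ +i* _).
  rewrite -H1; apply: Int_eq => u; rewrite /cexp /cRe /cIm /= cosN expR0; ring.
rewrite -[RHS]opprK -H2 -Int_N; last first.
  have [_ js] := intble_trig_mod _ t (trig_intble _ (fcos_translate_trig _ x bf)); exact: js.
by apply: Int_eq => u; rewrite /cexp /cRe /cIm /= sinN expR0; ring.
Qed.

Lemma wave_test_fun f (x r : R) (V : set R) : bump f -> (forall t, r <= `|t| -> f t = 0) ->
  (forall t, `|t| <= r -> V t) -> test_fun V (wave f x).
Proof.
move=> bf fr rV; split.
  have bc : bump (fun t => 2 * pi * f t).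
    have := bumpM _ _ bf (smooth_cst (2 * pi)); congr bump; apply/funext => t; ring.
  split.
    have [+ _] := bump_cos _ x bc; congr smoothR; apply/funext => t.
    by rewrite /cRe/= (mulrC x).
  have [+ _] := bump_sin _ x bc; congr smoothR; apply/funext => t.
  by rewrite /cIm/= (mulrC x).
exists `[- r, r]%classic; split; first exact: segment_compact.
  by move=> t /=; rewrite in_itv/= -ler_norml; exact: rV.
move=> t /=; rewrite in_itv/= -ler_norml => /negP; rewrite -ltNge => /ltW/fr tr.
by rewrite /wave tr mulr0 !mul0r.
Qed.

(** * Bounds from the pseudomeasure and conclusion *)

Lemma ae_mono (P Q : R -> Prop) : (forall x, P x -> Q x) ->
  {ae mu, forall x, P x} -> {ae mu, forall x, Q x}.
Proof.
move=> PQ [N [mN N0 sN]]; exists N; split=> // x nQ.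
by apply: sN => /= Px; apply: nQ; exact: PQ.
Qed.

Lemma ae_bounded_pairing (h W : R -> R) (M : R) : measurable_fun setT h ->
  {ae mu, forall x, `|h x| <= M} -> intble W ->
  `|Int (fun x => h x * W x)| <= `|M| * Int (fun x => `|W x|).
Proof.
(* Truncation changes [h] only on a null set and makes the bound hold at every point. *)
move=> mh hM jW; pose k x := Num.max (- `|M|) (Num.min (h x) `|M|).
have mk : measurable_fun setT k by apply: measurable_maxr => //; exact: measurable_minr.
have kM x : `|k x| <= `|M|.
  have m0 := normr_ge0 M.
  by rewrite ler_norml /k le_max lexx/= ge_max ge_min lexx orbT andbT; lra.
have mW := intble_meas _ jW.
have -> : Int (fun x => h x * W x) = Int (fun x => k x * W x).
  rewrite /Int /Rintegral; congr fine; apply: ae_eq_integral => //.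
  - by apply/measurable_EFinP; exact: measurable_funM.
  - by apply/measurable_EFinP; exact: measurable_funM.
  apply: ae_mono hM => x hx _ /=; congr (_ * _)%:E.
  have : `|h x| <= `|M| by exact: le_trans (ler_norm _).
  by rewrite ler_norml /k => /andP[h1 h2]; rewrite min_l// max_r.
rewrite -Int_Z; last exact: intble_norm.
apply: Int_bound.
- have := @intbleM _ `|M| _ _ jW mk kM; congr intble; apply/funext => x; exact: mulrC.
- exact/intbleZ/intble_norm.
- by move=> x; rewrite normrM ler_wpM2r.
Qed.

Lemma normC_parts (z : R[i]) (M : R) : `|z| <= M%:C -> `|cRe z| <= M /\ `|cIm z| <= M.
Proof.
case: z => a b; rewrite normc_def/= lecR => H.
have s (c d : R) : `|c| <= Num.sqrt (c ^+ 2 + d ^+ 2).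
  by rewrite -sqrtr_sqr ler_wsqrtr// lerDl sqr_ge0.
by split; apply: le_trans H; rewrite /cRe /cIm/= ?s// addrC s.
Qed.

Lemma pseudomeasure_bound (P : (R -> R[i]) -> R[i]) : pseudomeasure P ->
  exists2 M : R, 0 <= M & forall W, trig_transform W ->
    `|cRe (P (fourierT (fun u => (W u)%:C)))| <= M * Int (fun u => `|W u|) /\
    `|cIm (P (fourierT (fun u => (W u)%:C)))| <= M * Int (fun u => `|W u|).
Proof.
move=> [_ [h [[m1 [m2 [M hM]]] HP]]]; exists `|M| => // W tW.
have jW := trig_intble _ tW.
rewrite (HP _ (trig_schwartz _ tW)).
have E1 : cRe (cint setT (fun x => h x * (W x)%:C)) = Int (fun x => cRe (h x) * W x).
  by apply: Int_eq => x /=; case: (h x) => a b; rewrite /cRe/= mulr0 subr0.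
have E2 : cIm (cint setT (fun x => h x * (W x)%:C)) = Int (fun x => cIm (h x) * W x).
  by apply: Int_eq => x /=; case: (h x) => a b; rewrite /cIm/= mulr0 add0r.
rewrite E1 E2; split; apply: ae_bounded_pairing => //.
  by apply: ae_mono hM => x /normC_parts[].
by apply: ae_mono hM => x /normC_parts[].
Qed.

Lemma normC_le_parts (z : R[i]) (a b : R) : `|cRe z| <= a -> `|cIm z| <= b -> `|z| <= (a + b)%:C.
Proof.
case: z => x y; rewrite /cRe /cIm/= normc_def/= lecR => xa yb.
have a0 : 0 <= a by exact: le_trans xa.
have b0 : 0 <= b by exact: le_trans yb.
rewrite -[leRHS]ger0_norm ?addr_ge0// -sqrtr_sqr ler_wsqrtr//.
have := lerXn2r 2 (normr_ge0 x) a0 xa; have := lerXn2r 2 (normr_ge0 y) b0 yb.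
rewrite !real_normK ?num_real// => H1 H2.
by rewrite sqrrD; have := mulr_ge0 a0 b0; lra.
Qed.

(** Non-negativity in the order of [R[i]] includes being real, so the imaginary part vanishes from
    [x0] on. For the real part, which is non-negative there, [beta] may be enlarged to its absolute
    value. *)
Lemma exp_decreasing_of_T2 tau (x0 beta : R) : 0 <= x0 ->
  (forall x : R, x0 <= x -> 0 <= (expR (beta * x))%:C * tau x) ->
  (forall x y : R, x0 <= x -> x <= y ->
     (expR (beta * x))%:C * tau x <= (expR (beta * y))%:C * tau y) ->
  exp_decreasing (@cRe R \o tau) /\ exp_decreasing (@cIm R \o tau).
Proof.
move=> x00 t0 tm.
have RE z (r : R) : cRe (r%:C * z) = r * cRe z by case: z => p q; rewrite /cRe/= mul0r subr0.
have IE z (r : R) : cIm (r%:C * z) = r * cIm z by case: z => p q; rewrite /cIm/= mul0r addr0.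
have im0 x : x0 <= x -> cIm (tau x) = 0.
  move=> /t0; rewrite lecE => /andP[/eqP H _].
  have : expR (beta * x) * cIm (tau x) = 0 by rewrite -IE.
  by move/eqP; rewrite mulf_eq0 expR_eq0/= => /eqP.
have re0 x : x0 <= x -> 0 <= cRe (tau x).
  move=> /t0; rewrite lecE => /andP[_ H].
  have : 0 <= expR (beta * x) * cRe (tau x) by rewrite -RE.
  by rewrite pmulr_rge0// expR_gt0.
split; exists x0, `|beta|; split=> //; rewrite /comp.
- move=> x u x0x xu; have := tm _ _ x0x xu; rewrite lecE => /andP[_].
  rewrite -!/(cRe _) !RE => H.
  have e0 := expR_gt0 (beta * u).
  rewrite -(ler_pM2l e0); apply: le_trans H; rewrite mulrA ler_wpM2r ?re0//.
  rewrite -expRD ler_expR.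
  have : beta * (u - x) <= `|beta| * (u - x) by rewrite ler_wpM2r ?ler_norm ?subr_ge0.
  rewrite mulrBr; lra.
- by move=> x /im0 ->.
- by move=> x u x0x xu; rewrite !im0 ?mulr0//; exact: le_trans xu.
Qed.

Lemma laplace_real_converges tau (s : R) : (forall s : R[i], 0 < cRe s -> laplace_converges tau s) ->
  0 < s ->
  cvg (\int[mu]_(u in `[0, T]) (cRe (tau u) * expR (- (s * u))) @[T --> +oo]) /\
  cvg (\int[mu]_(u in `[0, T]) (cIm (tau u) * expR (- (s * u))) @[T --> +oo]).
Proof.
move=> lc s0; have [c1 c2] := lc (s +i* 0) s0.
rewrite (_ : (fun T => _) = (fun T => \int[mu]_(u in `[0, T]) (cRe (tau u) * expR (- (s * u))))) in c1; last first.
  apply/funext => T; apply: eq_Rintegral => x _ /=.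
  by have [H _] := laplace_integrand tau s 0 x; rewrite [LHS]H mul0r cos0 sin0; ring.
rewrite (_ : (fun T => _) = (fun T => \int[mu]_(u in `[0, T]) (cIm (tau u) * expR (- (s * u))))) in c2; last first.
  apply/funext => T; apply: eq_Rintegral => x _ /=.
  by have [_ H] := laplace_integrand tau s 0 x; rewrite [LHS]H mul0r cos0 sin0; ring.
by [].
Qed.

Lemma pm_boundary_means tau : (forall x, x < 0 -> tau x = 0) ->
  (forall s : R[i], 0 < cRe s -> laplace_converges tau s) ->
  (forall s, 0 < s -> intble (fun u => cRe (tau u) * expR (- (s * `|u|)))) ->
  (forall s, 0 < s -> intble (fun u => cIm (tau u) * expR (- (s * `|u|)))) ->
  pm_boundary (laplaceT tau) 0 ->
  exists f (B : R), [/\ bump f, forall v, 0 <= fcos f v, 0 < fcos f 0 &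
    forall y, (exists2 l, `|l| <= B &
      (fun n : nat => Int (fun u => cRe (tau u) * expR (- (n.+1%:R^-1 * `|u|)) * fcos f (u - y))) @ \oo --> l) /\
    (exists2 l, `|l| <= B &
      (fun n : nat => Int (fun u => cIm (tau u) * expR (- (n.+1%:R^-1 * `|u|)) * fcos f (u - y))) @ \oo --> l)].
Proof.
move=> t0 lc j1 j2 [a [b [ab [G [Gc Gl]]]]].
have [V [oV V0 Vab [P [pmP GP]]]] := Gl 0 ab.
have [r r0 rV] : exists2 r : R, 0 < r & forall t, `|t| <= r -> V t.
  have [r /= r0 H] := (@nbhs_ballP _ _ _ _).1 (open_nbhs_nbhs (conj oV V0)).
  exists (r / 2) => [|t tr]; first by lra.
  by apply: H; rewrite /ball /= sub0r normrN; lra.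
have [f [bf ef fr fp f0]] := kernel_exists r r0.
have [M M0 PM] := pseudomeasure_bound _ pmP.
have p20 : 0 < 2 * pi :> R by rewrite mulr_gt0// pi_gt0.
(* The bound is free of [y] because translating the non-negative kernel preserves its integral;
   dividing by [2 * pi] undoes the normalization of [wave]. *)
exists f, (M * Int (fcos f) / (2 * pi)); split=> // y.
have jK := trig_intble _ (fcos_trig _ bf).
(* Modulation leaves the support unchanged, so for every [y] the same bump stays inside the
   neighborhood where the boundary distribution is a pseudomeasure. *)
have tV := wave_test_fun f y r V bf fr rV.
have tab := wave_test_fun f y r `]a, b[%classic bf fr (fun t tr => Vab _ (rV _ tr)).
have [L1 L2] := Gc _ tab; rewrite (GP _ tV) in L1 L2.
have [B1 B2] := PM _ (fcos_translate_trig _ y bf).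
rewrite !(wave_fourierT f y bf ef) in B1 B2.
have [_ IK] := Int_shift y _ jK.
have IE : Int (fun u => `|fcos f (u + y)|) = Int (fcos f).
  by rewrite -IK; apply: Int_eq => u; rewrite ger0_norm.
rewrite IE in B1 B2.
have ce : (fun n : nat => n.+1%:R^-1 : R) @ \oo --> (0 : R) by exact: cvg_harmonic.
have e0 n : 0 < n.+1%:R^-1 :> R by rewrite invr_gt0.
have {}L1 := (cvg_at_rightP _ _ _).1 L1 _ (conj e0 ce).
have {}L2 := (cvg_at_rightP _ _ _).1 L2 _ (conj e0 ce).
have PR n := laplace_wave_pairing tau f n.+1%:R^-1 y bf ef t0 (j1 _ (e0 n)) (j2 _ (e0 n))
  (fun t => lc (n.+1%:R^-1 +i* t) (e0 n)).
have div (z : R) : `|z| <= M * Int (fcos f) -> `|(2 * pi)^-1 * z| <= M * Int (fcos f) / (2 * pi).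
  by move=> zM; rewrite normrM (gtr0_norm (_ : 0 < (2 * pi)^-1)) ?invr_gt0// mulrC ler_wpM2r// invr_ge0 ltW.
split.
  exists ((2 * pi)^-1 * cRe (P (wave f y))); first exact: div.
  rewrite (_ : (fun n => _) = (fun n : nat => (2 * pi)^-1 *
      cRe (cint setT (fun t => laplaceT tau (n.+1%:R^-1 +i* t) * wave f y t)))).
    by apply: cvgM; [exact: cvg_cst|exact: L1].
  by apply/funext => n; have [-> _] := PR n; rewrite mulKf// gt_eqF.
exists ((2 * pi)^-1 * cIm (P (wave f y))); first exact: div.
rewrite (_ : (fun n => _) = (fun n : nat => (2 * pi)^-1 *
    cIm (cint setT (fun t => laplaceT tau (n.+1%:R^-1 +i* t) * wave f y t)))).
  by apply: cvgM; [exact: cvg_cst|exact: L2].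
by apply/funext => n; have [_ ->] := PR n; rewrite mulKf// gt_eqF.
Qed.

Lemma component_bounded g f (B : R) : loc_intble g -> (forall x, x < 0 -> g x = 0) ->
  bdd_decreasingR g \/ exp_decreasing g ->
  (forall s, 0 < s -> intble (fun u => g u * expR (- (s * `|u|)))) ->
  bump f -> (forall v, 0 <= fcos f v) -> 0 < fcos f 0 ->
  (forall y, exists2 l, `|l| <= B &
      (fun n : nat => Int (fun u => g u * expR (- (n.+1%:R^-1 * `|u|)) * fcos f (u - y))) @ \oo --> l) ->
  exists x0 C, forall x, x0 <= x -> `|g x| <= C.
Proof.
move=> lg g0 tg jg bf fp f0 H.
have tf := fcos_trig _ bf; have jK := trig_intble _ tf.
have cK := smooth_continuous _ (trig_smooth _ tf).
have bK := trig_bounded _ tf.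
(* The first moment is finite because [v * fcos f v] is again a transform of bumps. *)
have jvK : intble (fun v => `|v| * fcos f v).
  have := intble_norm _ (trig_intble _ (trig_idM _ tf)); congr intble.
  by apply/funext => v; rewrite normrM (ger0_norm (fp v)).
have [x0 [A [A0 lin]]] := tauberian_lower_linear _ tg.
apply: (tauberian_bounded g B (fcos f)) => // y.
have [l lB cl] := H y.
have [jy Iy] := kernel_means_bounded g x0 A l y (fcos f) lg g0 A0 lin jg cK fp bK jK jvK cl.
by rewrite Iy.
Qed.

End Main.

Theorem theorem3p1 (R : realType) (tau : R -> R[i]) :
  L1loc tau ->
  (forall x : R, x < 0 -> tau x = 0) ->
  (forall s : R[i], 0 < cRe s -> laplace_converges tau s) ->
  (bdd_decreasing tau \/
   exists x0 beta : R, 0 <= x0 /\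
     (forall x : R, x0 <= x -> 0 <= (expR (beta * x))%:C * tau x) /\
     (forall x y : R, x0 <= x -> x <= y ->
        (expR (beta * x))%:C * tau x <= (expR (beta * y))%:C * tau y)) ->
  pm_boundary (laplaceT tau) 0 ->
  exists M : R, \forall x \near +oo, `| tau x | <= M%:C.
Proof.
move=> tloc t0 lc tT pm.
have l1 : loc_intble (@cRe R \o tau) by move=> a b; have [] := tloc a b.
have l2 : loc_intble (@cIm R \o tau) by move=> a b; have [] := tloc a b.
have z1 x : x < 0 -> (@cRe R \o tau) x = 0 by move=> x0; rewrite /= t0.
have z2 x : x < 0 -> (@cIm R \o tau) x = 0 by move=> x0; rewrite /= t0.
have [T1 T2] : (bdd_decreasingR (@cRe R \o tau) \/ exp_decreasing (@cRe R \o tau)) /\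
    (bdd_decreasingR (@cIm R \o tau) \/ exp_decreasing (@cIm R \o tau)).
  case: tT => [[b1 b2]|[x0 [beta [x00 [tp tm]]]]]; first by split; left.
  by have [e1 e2] := exp_decreasing_of_T2 tau x0 beta x00 tp tm; split; right.
have [x1 [A1 [A10 lin1]]] := tauberian_lower_linear _ T1.
have [x2 [A2 [A20 lin2]]] := tauberian_lower_linear _ T2.
have j1 s : 0 < s -> intble (fun u => cRe (tau u) * expR (- (s * `|u|))).
  move=> s0; have [c1 _] := laplace_real_converges tau s lc s0.
  exact: (laplace_abs (@cRe R \o tau) x1 A1 s l1 z1 A10 lin1 s0 c1).
have j2 s : 0 < s -> intble (fun u => cIm (tau u) * expR (- (s * `|u|))).
  move=> s0; have [_ c2] := laplace_real_converges tau s lc s0.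
  exact: (laplace_abs (@cIm R \o tau) x2 A2 s l2 z2 A20 lin2 s0 c2).
have [f [B [bf fp f0 H]]] := pm_boundary_means tau t0 lc j1 j2 pm.
have [X1 [C1 H1]] := component_bounded _ f B l1 z1 T1 j1 bf fp f0 (fun y => proj1 (H y)).
have [X2 [C2 H2]] := component_bounded _ f B l2 z2 T2 j2 bf fp f0 (fun y => proj2 (H y)).
exists (C1 + C2); near=> x; apply: normC_le_parts.
- by apply: H1; near: x; apply: nbhs_pinfty_ge; exact: num_real.
- by apply: H2; near: x; apply: nbhs_pinfty_ge; exact: num_real.
Unshelve. all: by end_near. Qed.
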